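(* Consider the two 3-stage ASIRK-3A methods $(\mathscr{B},\mathscr{C},\omega)$ given by the following coefficients. Method ASIRK-LSe(3,2): $$\mathscr{B}=\begin{pmatrix}0&0&0\\ \frac{573}{2980}&0&0\\ \frac{3}{20}&\frac{98}{89}&0\end{pmatrix},\quad \mathscr{C}=\begin{pmatrix}\frac{3}{20}&0&0\\ \frac{3}{20}&\frac{3}{20}&0\\ \frac{3}{20}&\frac{149}{280}&\frac{89}{280}\end{pmatrix},\quad \omega=\begin{pmatrix}\frac{3}{20}\\ \frac{149}{280}\\ \frac{89}{280}\end{pmatrix}.$$ Method ASIRK-LSs(3,2): $$\mathscr{B}=\begin{pmatrix}0&0&0\\ \frac{8407}{47450}&0&0\\ \frac{7}{50}&\frac{648}{599}&0\end{pmatrix},\quad \mathscr{C}=\begin{pmatrix}\frac{7}{50}&0&0\\ \frac{7}{50}&\frac{7}{50}&0\\ \frac{7}{50}&\frac{949}{1800}&\frac{599}{1800}\end{pmatrix},\quad \omega=\begin{pmatrix}\frac{7}{50}\\ \frac{949}{1800}\\ \frac{599}{1800}\end{pmatrix}.$$ Each of these two methods has the following properties. (a) It is a second order method for additive systems $y'=f(y)+g(y)$. (b) It can be implemented by using just three memory registers: with $\lambda_i=\mathscr{C}_{ii}$ there are $\gamma_1,\gamma_2\in\mathbb{R}$ such that $$\mathscr{B}=\begin{pmatrix}0&0&0\\ \omega_1+\gamma_1&0&0\\ \omega_1&\omega_2+\gamma_2&0\end{pmatrix},\qquad \mathscr{C}=\begin{pmatrix}\lambda_1&0&0\\ \omega_1&\lambda_2&0\\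 \omega_1&\omega_2&\lambda_3\end{pmatrix},$$ and the internal derivatives $K_1,K_2,K_3$ and the numerical solution $y_{n+1}$ are given by the recursion $$Y_i=Y_{i-1}+\omega_{i-1}K_{i-1},\qquad L_i=h f(Y_i+\gamma_{i-1}K_{i-1}),\qquad K_i=L_i+h g(Y_i+\lambda_iK_i),\qquad i=1,2,3,$$ $$y_{n+1}=Y_3+\omega_3K_3,$$ where $Y_0=y_n$, $\omega_0=\gamma_0=0$ (and $K_0=0$). (c) It satisfies the additional order conditions $\omega^te=1$, $\ \omega^t\mathscr{C}^{-1}(\mathscr{C}e)^2=1$, $\ \omega^t\mathscr{B}e=\tfrac12$. (d) Its implicit part satisfies $\lim_{z_2\to-\infty}R(0,z_2)=0$; thus the implicit method is $L$-stable, provided that it is $A$-stable. (e) For the linear model problem $$u'=\delta_1u+\sigma_1v,\qquad v'=\delta_2u+\sigma_2v+\frac1\varepsilon(cu-v),$$ with consistent initial values $v_0=cu_0$, the difference after one time step $h$ between the numerical solution $(u_1,v_1)$ and the exact solution $(u,v)$ is of the form $$u_1(\varepsilon,h)-u(\varepsilon,h)=\mathcal{O}(h^3,h^2\varepsilon),\qquad v_1(\varepsilon,h)-v(\varepsilon,h)=\mathcal{O}(h^3,h\varepsilon).$$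
   Context: An ASIRK-$s$A method (additive semi-implicit Runge-Kutta method) is given by a strictly lower triangular matrix $\mathscr{B}=(b_{ij})\in\mathbb{R}^{s\times s}$, a lower triangular matrix $\mathscr{C}=(c_{ij})\in\mathbb{R}^{s\times s}$ and a vector $\omega=(\omega_1,\dots,\omega_s)^t\in\mathbb{R}^s$. Applied with step size $h$ to an additive system $y'=f(y)+g(y)$, with $f,g:\mathbb{R}^N\to\mathbb{R}^N$ sufficiently smooth, it computes from $y_n$ $$K_i=h\Bigl(f\bigl(y_n+\sum_{j=1}^{i-1}b_{ij}K_j\bigr)+g\bigl(y_n+\sum_{j=1}^{i-1}c_{ij}K_j+c_{ii}K_i\bigr)\Bigr),\quad i=1,\dots,s,\qquad y_{n+1}=y_n+\sum_{i=1}^{s}\omega_iK_i .$$ The method is explicit in $f$ and diagonally implicit in $g$; its implicit part is the method obtained for $f=0$. Second order means that, for sufficiently smooth $f,g$, the local error after one step from exact data is $\mathcal{O}(h^3)$ as $h\to0$. Notation: $e=(1,\dots,1)^t\in\mathbb{R}^s$; powers of vectors are componentwise, so $(\mathscr{C}e)^2$ is the componentwise square of $\mathscr{C}e$; $I_s$ is the identity matrix. The function of absolute stability, obtained from the linear test equation $y'=\xi_1y+\xi_2y$ with $z_1=h\xi_1$, $z_2=h\xi_2$, $f(y)=\xi_1y$, $g(y)=\xi_2y$, is $$R(z_1,z_2)=1+(z_1+z_2)\,\omega^t(I_s-z_1\mathscr{B}-z_2\mathscr{C})^{-1}e .$$ The implicit part is $A$-stable if $|R(0,z_2)|\le1$ whenever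 $\mathrm{Re}\,z_2\le0$, and $L$-stable if in addition $R(0,z_2)\to0$ as $z_2\to-\infty$. A memory register is a vector of dimension $N$; the recursion in (b) uses one register for each of $Y_i$, $L_i$, $K_i$ (registers needed by a nonlinear solver are not counted). In (e), $\delta_1,\delta_2,\sigma_1,\sigma_2,c$ are constants and $\varepsilon>0$ is the stiffness parameter; accuracy for small values of $\varepsilon$ is studied. The method is applied with $y=(u,v)$, $f(u,v)=(\delta_1u+\sigma_1v,\ \delta_2u+\sigma_2v)$ and $g(u,v)=(0,\ (cu-v)/\varepsilon)$. The notation $\mathcal{O}(a,b)$ means $\mathcal{O}(a)+\mathcal{O}(b)$. With $\hat a=\delta_1+\sigma_1c$ and $\hat b=\delta_2+(\sigma_2-\delta_1)c-\sigma_1c^2$, the exact solution after one time step is taken in the form $$u(\varepsilon,h)=u_0\bigl(1+\hat ah+\tfrac12\hat a^2h^2+\sigma_1\hat bh\varepsilon\bigr)+\mathcal{O}(h^3,h\varepsilon^2),$$ $$v(\varepsilon,h)=u_0\bigl((1+\hat ah+\tfrac12\hat a^2h^2)c+\hat b\varepsilon+(\hat a+\sigma_1c)\hat bh\varepsilon\bigr)+\mathcal{O}(h^3,h\varepsilon^2).$$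
   Formalization: In (e) the O-terms, for the assumed exact expansion and for the claim, are read uniformly for small h with ε² ≤ κh³ (any κ > 0): over all small h and ε both fail, since a nonzero multiple of ε² remains in u. *)

(* Defs.v *)
(* MathComp + MathComp-Analysis; [R : realType] is the field of real numbers
   and [R[i]] its complexification. *)
From HB Require Import structures.
From mathcomp Require Import all_boot all_order all_algebra.
From mathcomp Require Import all_classical all_reals all_analysis.
From mathcomp Require Import complex.

Set Implicit Arguments.
Unset Strict Implicit.
Unset Printing Implicit Defensive.

Import Order.TTheory GRing.Theory Num.Theory.
Import numFieldNormedType.Exports.

Local Open Scope classical_set_scope.
Local Open Scope ring_scope.
Local Open Scope complex_scope.

Record asirk (R : realType) (s : nat) := Asirk {
  mB : 'M[R]_s;
  mC : 'M[R]_s;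
  mw : 'cV[R]_s;
  mB_strict_lower : forall i j : 'I_s, (i <= j)%N -> mB i j = 0;
  mC_lower : forall i j : 'I_s, (i < j)%N -> mC i j = 0 }.

(* The stages are only determined implicitly, hence a predicate on K. *)
Definition stages (R : realType) (s : nat) (M : asirk R s) (V : lmodType R)
    (f g : V -> V) (h : R) (y : V) (K : 'I_s -> V) : Prop :=
  forall i : 'I_s,
    K i = h *: (f (y + \sum_(j < s | (j < i)%N) mB M i j *: K j)
              + g (y + \sum_(j < s | (j < i)%N) mC M i j *: K j
                     + mC M i i *: K i)).

Definition update (R : realType) (s : nat) (M : asirk R s) (V : lmodType R)
    (y : V) (K : 'I_s -> V) : V :=
  y + \sum_(i < s) mw M i 0 *: K i.

(* Class C^k: the Frechet derivative exists everywhere and is of class C^(k-1);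
   in finite dimension this may be tested on each direction v. *)
Fixpoint classC (R : realType) (m n : nat) (k : nat)
    (f : 'rV[R]_m -> 'rV[R]_n) : Prop :=
  match k with
  | 0 => continuous f
  | k'.+1 => (forall x, differentiable f x) /\
             (forall v, classC k' (fun x => 'd f x v))
  end.

(* Local error O(h^3) for f and g of class C^2.  The stage equations may have
   further solutions that do not tend to 0 with h; the numerical solution is
   the one whose stages stay in a fixed ball (of any prescribed radius rho),
   which exists for all small h. *)
Definition second_order (R : realType) (s : nat) (M : asirk R s) : Prop :=
  forall (N : nat) (f g : 'rV[R]_N -> 'rV[R]_N),
  classC 2 f -> classC 2 g ->
  forall y : R -> 'rV[R]_N,
  (\forall t \near (0 : R), is_derive t (1 : R) y (f (y t) + g (y t))) ->
  forall rho : R, 0 < rho ->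
  exists A : R, \forall h \near (0 : R)^'+,
    (exists K, stages M f g h (y 0) K /\ forall i, `|K i| <= rho) /\
    (forall K, stages M f g h (y 0) K -> (forall i, `|K i| <= rho) ->
       `|update M (y 0) K - y h| <= A * h ^+ 3).

Definition mx3 (R : realType) (a11 a12 a13 a21 a22 a23 a31 a32 a33 : R)
    : 'M[R]_3 :=
  \matrix_(i, j) nth 0 (nth [::] [:: [:: a11; a12; a13];
                                     [:: a21; a22; a23];
                                     [:: a31; a32; a33]] i) j.

Definition cv3 (R : realType) (a1 a2 a3 : R) : 'cV[R]_3 :=
  \col_i nth 0 [:: a1; a2; a3] i.

Record registers (V : Type) := Registers { rY : V; rL : V; rK : V }.

(* One pass of the recursion, from the contents (Y_(i-1), L_(i-1), K_(i-1)) to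
   (Y_i, L_i, K_i), as three assignments.  Each of them overwrites one register
   and reads only the current contents of the three registers. *)
Definition register_pass (R : realType) (V : lmodType R) (f g : V -> V) (h : R)
    (om ga la : R) (r r' : registers V) : Prop :=
  let r1 := Registers (rY r + om *: rK r) (rL r) (rK r) in
  let r2 := Registers (rY r1) (h *: f (rY r1 + ga *: rK r1)) (rK r1) in
  exists k : V, k = rL r2 + h *: g (rY r2 + la *: k) /\
    r' = Registers (rY r2) (rL r2) k.

(* The initial content l0 of the register of L is irrelevant. *)
Definition three_registers (R : realType) (M : asirk R 3) : Prop :=
  let o1 := mw M 0 0 in let o2 := mw M 1 0 in let o3 := mw M 2%:R 0 in
  let l1 := mC M 0 0 in let l2 := mC M 1 1 in let l3 := mC M 2%:R 2%:R in
  exists g1 g2 : R,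
  [/\ mB M = mx3 0         0         0
                 (o1 + g1) 0         0
                 o1        (o2 + g2) 0,
      mC M = mx3 l1 0  0
                 o1 l2 0
                 o1 o2 l3
    & forall (N : nat) (f g : 'rV[R]_N -> 'rV[R]_N) (h : R)
             (y0 l0 : 'rV[R]_N) (K : 'I_3 -> 'rV[R]_N) (y1 : 'rV[R]_N),
        (stages M f g h y0 K /\ y1 = update M y0 K) <->
        (exists r1 r2 r3 : registers 'rV[R]_N,
          [/\ register_pass f g h 0 0 l1 (Registers y0 l0 0) r1,
              register_pass f g h o1 g1 l2 r1 r2,
              register_pass f g h o2 g2 l3 r2 r3,
              [/\ K 0 = rK r1, K 1 = rK r2 & K 2%:R = rK r3]
            & y1 = rY r3 + o3 *: rK r3])].

Definition ones (R : realType) (s : nat) : 'cV[R]_s := const_mx 1.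

Definition additional_order_conditions (R : realType) (s : nat)
    (M : asirk R s) : Prop :=
  [/\ (mw M)^T *m ones R s = 1%:M,
      mC M \in unitmx /\
      (mw M)^T *m invmx (mC M) *m map_mx (fun x => x ^+ 2) (mC M *m ones R s)
        = 1%:M
    & (mw M)^T *m mB M *m ones R s = (1 / 2)%:M].

(* The function R(z1, z2) of absolute stability. *)
Definition stability_function (R : realType) (s : nat) (M : asirk R s)
    (z1 z2 : R[i]) : R[i] :=
  let toC := fun x : R => x%:C in
  1 + (z1 + z2) *
    ((map_mx toC (mw M))^T
       *m invmx (1%:M - z1 *: map_mx toC (mB M) - z2 *: map_mx toC (mC M))
       *m const_mx 1 : 'M[R[i]]_1) 0 0.

Definition implicit_A_stable (R : realType) (s : nat) (M : asirk R s) : Prop :=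
  forall z2 : R[i], complex.Re z2 <= 0 -> `|stability_function M 0 z2| <= 1.

(* z2 tends to -oo along the real axis. *)
Definition implicit_damping (R : realType) (s : nat) (M : asirk R s) : Prop :=
  (stability_function M 0 x%:C : R[i]^o) @[x --> (-oo : set_system R)]
    --> (0 : R[i]^o).

Definition implicit_L_stable (R : realType) (s : nat) (M : asirk R s) : Prop :=
  implicit_A_stable M /\ implicit_damping M.

(* F(eps, h) = O(a(eps, h), b(eps, h)), i.e. O(a) + O(b), uniformly for small h
   in the stiff range 0 < eps <= sqrt(kappa) h^(3/2).  A range of this kind is
   implicit in the expansions of the model problem: with consistent initial
   values the initial layer contributes - sigma1 bhat u0 eps^2 to u, a term
   which is absent from the expansion of the exact solution, and which is
   O(h^3, h eps^2) if and only if eps^2 = O(h^3). *)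
Definition stiffO (R : realType) (kappa : R) (F a b : R -> R -> R) : Prop :=
  exists A h0 : R, 0 < h0 /\
    forall eps h : R, 0 < h < h0 -> 0 < eps -> eps ^+ 2 <= kappa * h ^+ 3 ->
      `|F eps h| <= A * (`|a eps h| + `|b eps h|).

Definition rv2 (R : realType) (a b : R) : 'rV[R]_2 :=
  \row_j nth 0 [:: a; b] j.

Section ModelProblem.
Variables (R : realType) (d1 d2 s1 s2 c : R).

Definition model_f (y : 'rV[R]_2) : 'rV[R]_2 :=
  rv2 (d1 * y 0 0 + s1 * y 0 1) (d2 * y 0 0 + s2 * y 0 1).

Definition model_g (eps : R) (y : 'rV[R]_2) : 'rV[R]_2 :=
  rv2 0 ((c * y 0 0 - y 0 1) / eps).

Definition model_solution (u0 eps : R) (u v : R -> R) : Prop :=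
  [/\ u 0 = u0, v 0 = c * u0
    & forall t : R,
        is_derive t (1 : R) u (d1 * u t + s1 * v t) /\
        is_derive t (1 : R) v (d2 * u t + s2 * v t + 1 / eps * (c * u t - v t))].

Definition ahat : R := d1 + s1 * c.
Definition bhat : R := d2 + (s2 - d1) * c - s1 * c ^+ 2.

Definition model_u (u0 eps h : R) : R :=
  u0 * (1 + ahat * h + 1 / 2 * ahat ^+ 2 * h ^+ 2 + s1 * bhat * h * eps).

Definition model_v (u0 eps h : R) : R :=
  u0 * ((1 + ahat * h + 1 / 2 * ahat ^+ 2 * h ^+ 2) * c + bhat * eps
        + (ahat + s1 * c) * bhat * h * eps).

(* u eps and v eps are the exact solution for the stiffness parameter eps;
   u1 eps h and v1 eps h are the numerical solution after one step. *)
Definition model_accuracy (s : nat) (M : asirk R s) : Prop :=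
  forall u0 kappa : R, 0 < kappa ->
  forall u v : R -> R -> R,
  (forall eps : R, 0 < eps -> model_solution u0 eps (u eps) (v eps)) ->
  stiffO kappa (fun eps h => u eps h - model_u u0 eps h)
    (fun eps h => h ^+ 3) (fun eps h => h * eps ^+ 2) ->
  stiffO kappa (fun eps h => v eps h - model_v u0 eps h)
    (fun eps h => h ^+ 3) (fun eps h => h * eps ^+ 2) ->
  (forall eps h : R, 0 < eps -> 0 < h ->
     exists K, stages M model_f (model_g eps) h (rv2 u0 (c * u0)) K) /\
  (forall u1 v1 : R -> R -> R,
    (forall eps h : R, 0 < eps -> 0 < h ->
       exists2 K, stages M model_f (model_g eps) h (rv2 u0 (c * u0)) K
         & rv2 (u1 eps h) (v1 eps h) = update M (rv2 u0 (c * u0)) K) ->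
    stiffO kappa (fun eps h => u1 eps h - u eps h)
      (fun eps h => h ^+ 3) (fun eps h => h ^+ 2 * eps) /\
    stiffO kappa (fun eps h => v1 eps h - v eps h)
      (fun eps h => h ^+ 3) (fun eps h => h * eps)).

End ModelProblem.

Lemma mx3_strict_lower (R : realType) (b21 b31 b32 : R) (i j : 'I_3) :
  (i <= j)%N -> mx3 0 0 0 b21 0 0 b31 b32 0 i j = 0.
Proof.
by rewrite mxE; case: i => [[|[|[|]]] //= ?]; case: j => [[|[|[|]]] //= ?].
Qed.

Lemma mx3_lower (R : realType) (c11 c21 c22 c31 c32 c33 : R) (i j : 'I_3) :
  (i < j)%N -> mx3 c11 0 0 c21 c22 0 c31 c32 c33 i j = 0.
Proof.
by rewrite mxE; case: i => [[|[|[|]]] //= ?]; case: j => [[|[|[|]]] //= ?].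
Qed.

Definition asirk3 (R : realType)
    (b21
     b31 b32
     c11
     c21 c22
     c31 c32 c33
     w1  w2  w3 : R) : asirk R 3 :=
  {| mB := mx3 0   0   0
               b21 0   0
               b31 b32 0;
     mC := mx3 c11 0   0
               c21 c22 0
               c31 c32 c33;
     mw := cv3 w1 w2 w3;
     mB_strict_lower := @mx3_strict_lower R b21 b31 b32;
     mC_lower := @mx3_lower R c11 c21 c22 c31 c32 c33 |}.

Definition ASIRK_LSe (R : realType) : asirk R 3 := asirk3
  (573 / 2980)
  (3 / 20)     (98 / 89)
  (3 / 20)
  (3 / 20)     (3 / 20)
  (3 / 20)     (149 / 280)  (89 / 280)
  (3 / 20)     (149 / 280)  (89 / 280).

(* b21 = 8407 / 47450, factored because ring numerals are unary. *)
Definition ASIRK_LSs (R : realType) : asirk R 3 := asirk3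
  ((7 * 1201) / (50 * 949))
  (7 / 50)     (648 / 599)
  (7 / 50)
  (7 / 50)     (7 / 50)
  (7 / 50)     (949 / 1800) (599 / 1800)
  (7 / 50)     (949 / 1800) (599 / 1800).

(* Main.v *)
Require Import Defs.
From HB Require Import structures.
From mathcomp Require Import all_boot all_order all_algebra.
From mathcomp Require Import all_classical all_reals all_analysis.
From mathcomp Require Import complex.
From mathcomp Require Import ring lra.

Set Implicit Arguments.
Unset Strict Implicit.
Unset Printing Implicit Defensive.

Import Order.TTheory GRing.Theory Num.Theory.
Import numFieldNormedType.Exports.

Local Open Scope classical_set_scope.
Local Open Scope ring_scope.

(** Both methods belong to one family [sa_method] of stiffly accurate methods:
    the weights form the last row of C, and the first column of C is constant,
    equal to w1, which is also the entry (3,1) of B.  Every claim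
    follows from this shape together with the polynomial identities and the
    positivity conditions collected in [sa_conditions], which the given
    coefficients satisfy.

    Second order ([second_order_of_conditions], for any number of stages) is a
    comparison of two expansions in h with remainder O(h^3), in which f and g
    enter only through a Lipschitz bound and a quadratic Taylor remainder near
    the initial value ([quadratic_at]).  The stages are bounded by rho, hence
    O(h), hence h (f + g) + O(h^2), hence known up to O(h^3)
    ([stages_expansion]); the same three steps, each by the mean value
    inequality, expand the exact solution ([solution_expansion]).  Stages exist
    because the stage equations are a contraction for small h
    ([stages_exist]).

    The register recursion is the stage equations with the sums accumulated.
    The rest of the linear theory uses that w^T is the last row of C: then
    w^T C^-1 selects the last entry, and R(0, z) is the last entry of
    (1 - z C)^-1 e, a rational function whose numerator has degree at most 1 and
    whose denominator has degree 3.

    For the model problem the right variable is the deviation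
    dev_i = (K_i)_v - c (K_i)_u of a stage from the slow direction (1, c).  It
    satisfies
      eps dev_i + h (C dev)_i = eps h (bhat U_i + (s2 - c s1) (B dev)_i),
    where U_i is the u-component of the argument of f.  Since the first column
    of C is w1 e, the leading term of dev is eps bhat u0 / w1 in the first stage
    and zero in the other two, where only O(eps h + eps^2 / h) remains
    ([layer]).  The identity w^T B C^-1 e = 1 then produces exactly the term
    s1 bhat h eps of the expansion of u, and the third stage equation, whose
    left side is eps dev_3 + h w^T dev, produces the term bhat eps of the
    expansion of v.  The remainders are absorbed with eps^2 = O(h^3)
    ([error_u_bound], [error_v_bound]). *)

(** * Mean value inequality and Taylor remainders *)

Lemma mx_norm_entry (R : realType) (m n : nat) (M : 'M[R]_(m, n)) i j :
  `|M i j| <= `|M|.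
Proof.
rewrite [leRHS]/Num.Def.normr/= mx_normrE.
exact: (le_bigmax _ (fun ij : 'I_m * 'I_n => `|M ij.1 ij.2|) (i, j)).
Qed.

(** The sup norm reduces this to the scalar mean value theorem, applied to each
    entry of f. *)
Lemma mean_value_bound (R : realType) (N : nat) (f df : R -> 'rV[R]_N)
    (h C : R) :
  0 <= h ->
  (forall t, 0 <= t <= h -> is_derive t (1 : R) f (df t)) ->
  (forall t, 0 <= t <= h -> `|df t| <= C) ->
  `|f h - f 0| <= C * h.
Proof.
move=> h0 fdf dfC.
have C0 : 0 <= C by apply: le_trans (normr_ge0 _) (dfC 0 _); rewrite lexx.
rewrite [leLHS]/Num.Def.normr/= mx_normrE.
apply: bigmax_le => [|[i j] _ /=]; first exact: mulr_ge0.
have dfij t : 0 <= t <= h -> is_derive t (1 : R) (fun x => f x i j) (df t i j).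
  move=> th; have [/[dup] dt /derivable_mxP dtij <-] := fdf t th.
  by apply: DeriveDef => //; rewrite derive_mx// mxE.
have [||c ch] := @MVT_segment _ (fun x => f x i j) (fun x => df x i j) _ _ h0.
- by move=> x; rewrite in_itv/= => /andP[x0 xh]; apply: dfij; rewrite !ltW.
- apply: derivable_within_continuous => x; rewrite in_itv/= => xh.
  by have [] := dfij x xh.
rewrite !mxE subr0 => ->; rewrite normrM (ger0_norm h0) ler_wpM2r//.
by apply: le_trans (mx_norm_entry _ _ _) _; apply: dfC; rewrite in_itv/= in ch.
Qed.

(** Turns estimates on the finitely many basis vectors into estimates that are
    uniform in v; here A will be a difference of two derivatives. *)
Lemma linear_basis_bound (R : realType) (N m : nat) (A : 'rV[R]_N -> 'rV[R]_m)
    (v : 'rV[R]_N) :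
  linear A -> `|A v| <= (\sum_j `|A (delta_mx 0 j)|) * `|v|.
Proof.
move=> Alin.
pose Am := GRing.isLinear.Build _ _ _ _ A Alin.
pose AL : {linear _ -> _} := HB.pack A Am.
rewrite -[A]/(AL : _ -> _) {1}(row_sum_delta v) linear_sum mulr_suml.
apply: le_trans (ler_norm_sum _ _ _) _; apply: ler_sum => j _.
by rewrite linearZ normrZ mulrC ler_wpM2l// mx_norm_entry.
Qed.

Lemma differentiable_local_lipschitz (R : realType) (V W : normedModType R)
    (G : V -> W) (x0 : V) :
  differentiable G x0 ->
  exists2 K, 0 <= K & \forall x \near x0, `|G x - G x0| <= K * `|x - x0|.
Proof.
move=> dG; have [k k0 kP] := linear_lipschitz (diff_continuous dG).
exists (k + 1); first by rewrite addr_ge0// ltW.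
have := diff_locally dG => /eqaddoP/(_ 1 ltr01) Gx.
rewrite (near_shift 0 x0) subr0; near=> x => /=.
have : `|(G \o shift x0 - (cst (G x0) + 'd G x0)) x| <= 1 * `|x|.
  by near: x; exact: Gx.
rewrite mul1r !fctE/= addrK opprD addrA => Gxx.
rewrite -[G (x + x0) - G x0](subrK ('d G x0 x)) mulrDl mul1r addrC.
by rewrite (le_trans (ler_normD _ _))// lerD.
Unshelve. all: by end_near. Qed.

Lemma classC2_diff (R : realType) (N m : nat) (f : 'rV[R]_N -> 'rV[R]_m) :
  classC 2 f -> (forall x, differentiable f x) /\
    forall v x, differentiable (fun x => 'd f x v) x.
Proof. by move=> [df dfC]; split=> [|v x]; [exact: df|exact: (dfC v).1]. Qed.

(** Class C^2 gives, for each direction v separately, differentiability of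
    x |-> 'd f x v; finite dimension makes the resulting Lipschitz estimate at
    x0 uniform in v. *)
Lemma linear_family_local_lipschitz (R : realType) (N m : nat)
    (F : 'rV[R]_N -> {linear 'rV[R]_N -> 'rV[R]_m}) (x0 : 'rV[R]_N) :
  (forall v, differentiable (fun x => F x v) x0) ->
  exists2 K : R, 0 <= K & \forall x \near x0, forall v,
    `|F x v - F x0 v| <= K * `|x - x0| * `|v|.
Proof.
move=> dF.
have /choice[K KP] (j : 'I_N) : exists K : R, 0 <= K /\ \forall x \near x0,
    `|F x (delta_mx 0 j) - F x0 (delta_mx 0 j)| <= K * `|x - x0|.
  have [K K0 KP] := differentiable_local_lipschitz (dF (delta_mx 0 j)).
  by exists K.
have nearK := filter_forall (nbhs_filter x0) (fun j => (KP j).2).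
exists (\sum_j K j); first by apply: sumr_ge0 => j _; case: (KP j).
apply: filterS nearK => x Kx v.
apply: le_trans (@linear_basis_bound _ _ _ (fun v => F x v - F x0 v) v _) _.
  by move=> a u w; rewrite 2!linearD 2!linearZ_LR scalerBr opprD addrACA.
by rewrite ler_wpM2r// mulr_suml ler_sum.
Qed.
Lemma diff_local_lipschitz (R : realType) (N m : nat)
    (f : 'rV[R]_N -> 'rV[R]_m) (x0 : 'rV[R]_N) :
  classC 2 f ->
  exists2 K : R, 0 <= K & \forall x \near x0, forall v,
    `|'d f x v - 'd f x0 v| <= K * `|x - x0| * `|v|.
Proof.
move=> /classC2_diff[_ d2f].
exact: (@linear_family_local_lipschitz _ _ _ (fun x => 'd f x)).
Qed.

Lemma is_derive_segment (R : realType) (N m : nat)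
    (f : 'rV[R]_N -> 'rV[R]_m) (x k : 'rV[R]_N) (t : R) :
  differentiable f (x + t *: k) ->
  is_derive t (1 : R) (fun t => f (x + t *: k)) ('d f (x + t *: k) k).
Proof.
move=> df; have dk : derivable f (x + t *: k) k by exact: diff_derivable.
have E : (fun h : R => h^-1 *:
     (((fun t => f (x + t *: k)) \o shift t) (h *: (1 : R)) - f (x + t *: k))) =
   (fun h : R => h^-1 *: ((f \o shift (x + t *: k)) (h *: k)
     - f (x + t *: k))).
  apply/funext => h /=; congr (_ *: (f _ - _)).
  by rewrite scalerDl addrCA /GRing.scale/= mulr1.
apply: DeriveDef; first by rewrite /derivable E.
by rewrite -(deriveE k df) /derive E.
Qed.
Lemma is_derive_scaled_vector (R : realType) (V : normedModType R)
    (phi : R -> R) (w : V) (t dphi : R) :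
  is_derive t (1 : R) phi dphi ->
  is_derive t (1 : R) (fun s => phi s *: w) (dphi *: w).
Proof.
move=> [dphi1 <-].
have cv : (fun h : R => h^-1 *: (((fun s => phi s *: w) \o shift t) (h *: (1 : R))
    - phi t *: w)) @ 0^' --> 'D_1 phi t *: w.
  under eq_fun do rewrite /= -scalerBl scalerA.
  by apply: cvgZr_tmp; exact: dphi1.
apply: DeriveDef; first by apply/cvg_ex; eexists; exact: cv.
exact: cvg_lim cv.
Qed.

(** All that the order analysis uses of a vector field near x0. *)
Record quadratic_at (R : realType) (N m : nat) (f : 'rV[R]_N -> 'rV[R]_m)
    (A : {linear 'rV[R]_N -> 'rV[R]_m}) (x0 : 'rV[R]_N) (r L : R) : Prop := {
  quadratic_rem : forall k, `|k| <= r ->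
    `|f (x0 + k) - f x0 - A k| <= L * `|k| ^+ 2;
  quadratic_lin : forall k, `|A k| <= L * `|k|;
  quadratic_lip : forall k k', `|k| <= r -> `|k'| <= r ->
    `|f (x0 + k) - f (x0 + k')| <= L * `|k - k'| }.

Lemma quadratic_atW (R : realType) (N m : nat) (f : 'rV[R]_N -> 'rV[R]_m)
    (A : {linear 'rV[R]_N -> 'rV[R]_m}) (x0 : 'rV[R]_N) (r r' L L' : R) :
  r' <= r -> L <= L' -> quadratic_at f A x0 r L -> quadratic_at f A x0 r' L'.
Proof.
move=> rr LL [rem lin lip]; split => [k kr|k|k k' kr kr'].
- apply: le_trans (rem k (le_trans kr rr)) _.
  by rewrite ler_wpM2r ?exprn_ge0.
- by apply: le_trans (lin k) _; rewrite ler_wpM2r.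
- apply: le_trans (lip k k' (le_trans kr rr) (le_trans kr' rr)) _.
  by rewrite ler_wpM2r.
Qed.

Lemma quadratic_atD (R : realType) (N m : nat) (f g : 'rV[R]_N -> 'rV[R]_m)
    (A B : {linear 'rV[R]_N -> 'rV[R]_m}) (x0 : 'rV[R]_N) (r L : R) :
  quadratic_at f A x0 r L -> quadratic_at g B x0 r L ->
  quadratic_at (f \+ g) (A \+ B) x0 r (L + L).
Proof.
move=> [remf linf lipf] [remg ling lipg]; split => [k kr|k|k k' kr kr'] /=.
- rewrite mulrDl; apply: le_trans (lerD (remf k kr) (remg k kr)).
  apply: le_trans (ler_normD _ _).
  by rewrite !opprD (addrACA (f _)) [X in `|X| <= _]addrACA.
- by rewrite mulrDl; apply: le_trans (ler_normD _ _) (lerD _ _).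
- rewrite mulrDl opprD addrACA.
  by apply: le_trans (ler_normD _ _) (lerD _ _); [exact: lipf|exact: lipg].
Qed.

(** Along a segment issuing from x0 the derivative varies by O(|k|), so that the
    mean value inequality for f - 'd f x0 gives the quadratic remainder; the
    same inequality along an arbitrary segment of the ball gives the Lipschitz
    bound. *)
Lemma classC2_quadratic (R : realType) (N m : nat) (f : 'rV[R]_N -> 'rV[R]_m)
    (x0 : 'rV[R]_N) :
  classC 2 f ->
  exists r L : R, [/\ 0 < r, 0 <= L & quadratic_at f ('d f x0) x0 r L].
Proof.
move=> fC; have [K K0 /nbhs_normP[e /= e0 Ke]] := diff_local_lipschitz x0 fC.
have df := fC.1.
have [k0 k00 Ak0] := linear_lipschitz (diff_continuous (df x0)).
pose r := e / 2.
have r0 : 0 < r by rewrite divr_gt0.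
have Kr k v : `|k| <= r -> `|'d f (x0 + k) v - 'd f x0 v| <= K * `|k| * `|v|.
  move=> kr; rewrite -[in leRHS](addKr x0 k) [- x0 + _]addrC; apply: Ke => /=.
  rewrite opprD addrA subrr add0r normrN (le_lt_trans kr)//.
  by rewrite /r gtr_pMr// invf_lt1// ltr1n.
have r0' := ltW r0; have k00' := ltW k00.
have Kr0 : 0 <= K * r by apply: mulr_ge0.
have [L0 L1 L2] : [/\ k0 <= K * r + k0 + K, K <= K * r + k0 + K &
  K * r + k0 <= K * r + k0 + K] by split; lra.
exists r, (K * r + k0 + K); split=> //; first lra.
split=> [k kr|k|k k' kr kr'].
- pose phi (t : R) := f (x0 + t *: k) - t *: 'd f x0 k.
  have -> : f (x0 + k) - f x0 - 'd f x0 k = phi 1 - phi 0.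
    by rewrite /phi !scale1r !scale0r addr0 subr0 addrAC.
  rewrite -[leRHS]mulr1.
  apply: (@mean_value_bound _ _ phi
    (fun t => 'd f (x0 + t *: k) k - 'd f x0 k) 1 _ ler01) => t /andP[t0 t1].
    have dft := is_derive_segment (df (x0 + t *: k)).
    have dt := is_derive_scaled_vector ('d f x0 k) (is_derive_id t (1 : R)).
    by rewrite scale1r in dt; exact: (is_deriveB dft dt).
  have tk : `|t *: k| <= `|k| by rewrite normrZ ger0_norm// ler_piMl.
  apply: le_trans (Kr _ _ (le_trans tk kr)) _.
  rewrite expr2 mulrA; apply: ler_wpM2r => //.
  by apply: ler_pM.
- by apply: le_trans (Ak0 k) _; rewrite ler_wpM2r.
- pose phi (t : R) := f ((x0 + k') + t *: (k - k')).
  have -> : f (x0 + k) - f (x0 + k') = phi 1 - phi 0.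
    by rewrite /phi scale1r scale0r addr0 -addrA [k' + _]addrC subrK.
  rewrite -[leRHS]mulr1.
  apply: (@mean_value_bound _ _ phi
    (fun t => 'd f ((x0 + k') + t *: (k - k')) (k - k')) 1 _ ler01)
    => t /andP[t0 t1].
    exact: is_derive_segment.
  have tk : `|k' + t *: (k - k')| <= r.
    have -> : k' + t *: (k - k') = (1 - t) *: k' + t *: k.
      by rewrite scalerBl scale1r scalerBr addrA addrAC.
    apply: le_trans (ler_normD _ _) _; rewrite !normrZ (ger0_norm t0).
    rewrite ger0_norm ?subr_ge0//.
    have -> : r = (1 - t) * r + t * r by rewrite -mulrDl subrK mul1r.
    by apply: lerD; apply: ler_wpM2l; rewrite ?subr_ge0.
  apply: le_trans (_ : (K * r + k0) * `|k - k'| <= _); last first.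
    by rewrite ler_wpM2r.
  rewrite -[X in `|X|](subrK ('d f x0 (k - k'))).
  apply: le_trans (ler_normD _ _) _; rewrite mulrDl lerD//.
  rewrite -addrA; apply: le_trans (Kr _ _ tk) _.
  by rewrite ler_wpM2r// ler_wpM2l.
Qed.

(** Stages are a priori only bounded by a radius rho that need not be small, so
    a bound on f over a large ball is needed before any local estimate
    applies. *)
Lemma continuous_bounded_ball (R : realType) (N m : nat)
    (f : 'rV[R]_N -> 'rV[R]_m) (x0 : 'rV[R]_N) (rho : R) :
  continuous f ->
  exists2 B : R, 0 <= B & forall k, `|k| <= rho -> `|f (x0 + k)| <= B.
Proof.
move=> cf; pose r : R := Num.max rho 1.
have r0 : 0 < r by rewrite /r lt_max ltr01 orbT.
have bA : bounded_set (closed_ball x0 r).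
  exists (`|x0| + r); split=> [|b /ltW rb x]; first exact: num_real.
  rewrite /= closed_ballE// /closed_ball_/= => xr.
  apply: le_trans rb.
  by rewrite -[x](subrK x0) addrC (le_trans (ler_normD _ _))// lerD// distrC.
have cA : compact (closed_ball x0 r).
  apply: bounded_closed_compact bA _; exact: closed_ball_closed.
have cfA : {within closed_ball x0 r, continuous f} by exact: continuous_subspaceT.
have [B [_ fB]] := compact_bounded (continuous_compact cfA cA).
exists (Num.max B 0 + 1) => [|k kr]; first by rewrite addr_ge0// le_max lexx orbT.
apply: (fB (Num.max B 0 + 1)); first by rewrite ltr_pwDr// le_max lexx.
exists (x0 + k) => //.
rewrite closed_ballE// /closed_ball_/= opprD addrA subrr sub0r normrN.
by rewrite (le_trans kr)// /r le_max lexx.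
Qed.

(** * Expansion of the exact solution *)
Lemma is_derive_half_sqr (R : realType) (t : R) :
  is_derive t (1 : R) (fun s : R => s ^+ 2 / 2) t.
Proof.
have -> : (fun s : R => s ^+ 2 / 2) = 2^-1 \*: (id ^+ 2 : R -> R).
  by apply/funext => s; rewrite mulrC.
apply: is_derive_eq (is_deriveZ 2^-1 (is_deriveX 2 (is_derive_id t (1 : R)))) _.
by rewrite /= expr1 /GRing.scale/=; field.
Qed.

(** Three rounds of the mean value inequality: y - y0 is O(t), hence F(y) - F0
    is O(t) and y - y0 - t F0 is O(t^2), hence the derivative of the difference
    to be estimated is O(t^2). *)
Lemma solution_expansion (R : realType) (N : nat) (F : 'rV[R]_N -> 'rV[R]_N)
    (A : {linear 'rV[R]_N -> 'rV[R]_N}) (r L : R) (y : R -> 'rV[R]_N) :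
  0 < r -> 0 <= L -> quadratic_at F A (y 0) r L ->
  (\forall t \near (0 : R), is_derive t (1 : R) y (F (y t))) ->
  exists Q : R, \forall h \near (0 : R)^'+,
    `|y h - (y 0 + h *: F (y 0) + (h ^+ 2 / 2) *: A (F (y 0)))| <= Q * h ^+ 3.
Proof.
move=> r0 L0 [rem lin lip] dy; set F0 := F (y 0).
have cy : {for (0 : R), continuous y}.
  apply: differentiable_continuous; apply/derivable1_diffP.
  by have [] := nbhs_singleton dy.
have yr : \forall t \near (0 : R), `|y t - y 0| <= r.
  by move/cvgrPdist_le : cy => /(_ r r0); apply: filterS => t; rewrite distrC.
have /nbhs_normP[e /= e0 ye] : \forall t \near (0 : R),
    is_derive t (1 : R) y (F (y t)) /\ `|y t - y 0| <= r.
  by apply: filterS2 dy yr.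
have {dy cy yr} ye t : 0 <= t < e ->
    is_derive t (1 : R) y (F (y t)) /\ `|y t - y 0| <= r.
  by move=> /andP[t0 te]; apply: ye; rewrite /ball_/= sub0r normrN ger0_norm.
have Fy t : 0 <= t < e -> `|F (y t) - F0| <= L * `|y t - y 0|.
  move=> te; have := @lip (y t - y 0) 0.
  rewrite [y 0 + (_ - _)]addrC subrK addr0 subr0 normr0; apply; last exact: ltW.
  exact: (ye t te).2.
pose M := `|F0| + L * r.
have M0 : 0 <= M by rewrite /M addr_ge0// mulr_ge0// ltW.
have sub t h : 0 <= t <= h -> h < e -> 0 <= t < e.
  by move=> /andP[-> th] he; rewrite (le_lt_trans th).
have D1 h : 0 <= h < e -> `|y h - y 0| <= M * h.
  move=> /andP[h0 he].
  apply: (mean_value_bound h0) => t /sub/(_ he) te /=; first exact: (ye t te).1.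
  rewrite /= -[F (y t)](subrK F0) [_ + F0]addrC (le_trans (ler_normD _ _))// lerD//.
  by rewrite (le_trans (Fy t te))// ler_wpM2l//; have [] := ye t te.
have D2 h : 0 <= h < e -> `|y h - y 0 - h *: F0| <= L * M * h ^+ 2.
  move=> /andP[h0 he].
  have -> : y h - y 0 - h *: F0 = (y h - h *: F0) - (y 0 - 0 *: F0).
    by rewrite scale0r subr0 addrAC.
  rewrite expr2 mulrA.
  apply: (@mean_value_bound _ _ (fun t => y t - t *: F0)
    (fun t => F (y t) - F0) _ _ h0) => t /[dup] th /sub/(_ he) te.
    have dt := is_derive_scaled_vector F0 (is_derive_id t (1 : R)).
    by rewrite scale1r in dt; exact: (is_deriveB (ye t te).1 dt).
  rewrite (le_trans (Fy t te))// -mulrA ler_wpM2l// (le_trans (D1 t te))//.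
  by rewrite ler_wpM2l//; case/andP: th.
pose Q := L * M ^+ 2 + L * (L * M).
have D3 h : 0 <= h < e ->
    `|y h - y 0 - h *: F0 - (h ^+ 2 / 2) *: A F0| <= Q * h ^+ 3.
  move=> /andP[h0 he].
  have -> : y h - y 0 - h *: F0 - (h ^+ 2 / 2) *: A F0 =
      (y h - h *: F0 - (h ^+ 2 / 2) *: A F0)
      - (y 0 - 0 *: F0 - (0 ^+ 2 / 2) *: A F0).
    by rewrite expr0n/= mul0r !scale0r !subr0 [RHS]addrAC [y h - h *: F0 - _]addrAC.
  rewrite [h ^+ 3 in leRHS]exprSr [leRHS]mulrA.
  apply: (@mean_value_bound _ _ (fun t => y t - t *: F0 - (t ^+ 2 / 2) *: A F0)
    (fun t => F (y t) - F0 - t *: A F0) _ _ h0) => t /[dup] th /sub/(_ he) te.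
    have dt := is_derive_scaled_vector F0 (is_derive_id t (1 : R)).
    have dt2 := is_derive_scaled_vector (A F0) (is_derive_half_sqr t).
    rewrite scale1r in dt.
    exact: (is_deriveB (is_deriveB (ye t te).1 dt) dt2).
  have [t0 tle] := andP th.
  have -> : F (y t) - F0 - t *: A F0 =
     (F (y t) - F0 - A (y t - y 0)) + A (y t - y 0 - t *: F0).
    by rewrite [A (_ - _ *: _)]linearB [A (_ *: _)]linearZ_LR addrA subrK.
  have yt := (ye t te).2.
  have := rem (y t - y 0) yt; rewrite [y 0 + _]addrC subrK => rt.
  rewrite (le_trans (ler_normD _ _))// /Q mulrDl lerD//.
    rewrite (le_trans rt)// -mulrA ler_wpM2l// -exprMn lerXn2r ?nnegrE//.
      by rewrite mulr_ge0.
    by rewrite (le_trans (D1 t te))// ler_wpM2l.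
  rewrite (le_trans (lin _))// -mulrA ler_wpM2l// (le_trans (D2 t te))//.
  by rewrite ler_wpM2l ?mulr_ge0// lerXn2r ?nnegrE.
exists Q; near=> h.
rewrite !opprD !addrA; apply: D3; apply/andP; split; first exact: ltW.
by near: h; exact: nbhs_right_lt.
Unshelve. all: by end_near. Qed.

(** * Existence of the stages *)

(** Triangularity lets the partial sums of the definition run over all
    indices, which makes both coefficient matrices play the same role. *)
Lemma stagesE (R : realType) (s : nat) (M : asirk R s) (V : lmodType R)
    (f g : V -> V) (h : R) (y : V) (K : 'I_s -> V) :
  stages M f g h y K <->
  forall i, K i = h *: (f (y + \sum_j mB M i j *: K j)
                      + g (y + \sum_j mC M i j *: K j)).
Proof.
have EB (i : 'I_s) :
    \sum_(j < s | (j < i)%N) mB M i j *: K j = \sum_j mB M i j *: K j.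
  rewrite big_mkcond; apply: eq_bigr => j _; case: ltnP => // ij.
  by rewrite mB_strict_lower// scale0r.
have EC (i : 'I_s) : \sum_(j < s | (j < i)%N) mC M i j *: K j + mC M i i *: K i
    = \sum_j mC M i j *: K j.
  rewrite [RHS](bigD1 i)//= addrC; congr (_ + _).
  rewrite big_mkcond [RHS]big_mkcond; apply: eq_bigr => j _.
  rewrite -(inj_eq val_inj)/=; case: ltngtP => //= ij.
  by rewrite mC_lower// scale0r.
by split=> KE i; have := KE i; rewrite EB -addrA EC.
Qed.

Lemma norm_weighted_sum (R : realType) (V : normedModType R) (s : nat)
    (a : 'I_s -> R) (K : 'I_s -> V) (T P : R) :
  \sum_j `|a j| <= T -> 0 <= P -> (forall j, `|K j| <= P) ->
  `|\sum_j a j *: K j| <= T * P.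
Proof.
move=> aT P0 KP; apply: le_trans (ler_norm_sum _ _ _) _.
apply: le_trans (_ : \sum_j `|a j| * P <= _).
  by apply: ler_sum => j _; rewrite normrZ ler_wpM2l.
by rewrite -mulr_suml ler_wpM2r.
Qed.

Lemma coefficients_bounded (R : realType) (s : nat) (M : asirk R s) :
  exists T : R, [/\ 0 <= T, forall i, \sum_j `|mB M i j| <= T,
    forall i, \sum_j `|mC M i j| <= T & \sum_i `|mw M i 0| <= T].
Proof.
pose TB := \sum_i \sum_j `|mB M i j|; pose TC := \sum_i \sum_j `|mC M i j|.
pose Tw := \sum_i `|mw M i 0|.
have TB0 : 0 <= TB by rewrite !sumr_ge0// => i _; rewrite sumr_ge0.
have TC0 : 0 <= TC by rewrite !sumr_ge0// => i _; rewrite sumr_ge0.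
have Tw0 : 0 <= Tw by rewrite sumr_ge0.
have le_sum (G : 'I_s -> R) i : (forall i, 0 <= G i) -> G i <= \sum_i G i.
  by move=> G0; rewrite (bigD1 i)//= lerDl sumr_ge0.
exists (TB + TC + Tw); split=> [|i|i|]; first lra.
- have := le_sum (fun i => \sum_j `|mB M i j|) i; rewrite -/TB => leB.
  have {}leB := leB (fun i => sumr_ge0 _ (fun j _ => normr_ge0 _)); lra.
- have := le_sum (fun i => \sum_j `|mC M i j|) i; rewrite -/TC => leC.
  have {}leC := leC (fun i => sumr_ge0 _ (fun j _ => normr_ge0 _)); lra.
- rewrite -/Tw; lra.
Qed.

Lemma rowwise_norm (R : realType) (s N : nat) (K : 'M[R]_(s, N)) (c : R) :
  0 <= c -> (forall i, `|row i K| <= c) -> `|K| <= c.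
Proof.
move=> c0 Kc; rewrite [leLHS]/Num.Def.normr/= mx_normrE.
apply: bigmax_le => [//|[i j] _ /=]; apply: le_trans (Kc i).
by apply: le_trans (mx_norm_entry _ 0 j); rewrite mxE.
Qed.

Lemma norm_row (R : realType) (s N : nat) (K : 'M[R]_(s, N)) i :
  `|row i K| <= `|K|.
Proof.
rewrite [leLHS]/Num.Def.normr/= mx_normrE.
by apply: bigmax_le => [//|[i' j] _ /=]; rewrite mxE mx_norm_entry.
Qed.

Lemma near0_mul_lt (R : realType) (c e : R) :
  0 <= c -> 0 < e -> \forall h \near (0 : R)^'+, h * c < e.
Proof.
move=> c0 e0; have c1 : 0 < c + 1 by rewrite ltr_wpDl.
near=> h; have h0 : 0 < h by [].
apply: le_lt_trans (_ : h * (c + 1) < e).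
  by rewrite ler_wpM2l ?lerDl// ltW.
rewrite -ltr_pdivlMr//; near: h; apply: nbhs_right_lt.
by rewrite divr_gt0.
Unshelve. all: by end_near. Qed.

(** Banach's fixed point theorem for all stages at once, the stages being the
    rows of an s x N matrix: for h small the right side of the stage equations
    maps a small closed ball into itself and contracts it. *)
Lemma stages_exist (R : realType) (s N : nat) (M : asirk R s)
    (f g : 'rV[R]_N -> 'rV[R]_N) (A B : {linear 'rV[R]_N -> 'rV[R]_N})
    (x0 : 'rV[R]_N) (r L rho : R) :
  0 < r -> 0 <= L -> 0 < rho ->
  quadratic_at f A x0 r L -> quadratic_at g B x0 r L ->
  \forall h \near (0 : R)^'+,
    exists K, stages M f g h x0 K /\ forall i, `|K i| <= rho.
Proof.
move=> r0 L0 rho0 [_ _ lipf] [_ _ lipg].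
have [T [T0 TB TC _]] := coefficients_bounded M.
pose rho' := Num.min rho (r / (T + 1)).
have rho'0 : 0 < rho' by rewrite lt_min rho0 divr_gt0// ltr_wpDl.
have Trho : T * rho' <= r.
  apply: le_trans (_ : (T + 1) * (r / (T + 1)) <= _).
    by apply: ler_pM => //; [exact: ltW|rewrite lerDl|rewrite ge_min lexx orbT].
  by rewrite mulrC divfK// gt_eqF// ltr_wpDl.
pose Phi h (K : 'M[R]_(s, N)) : 'M[R]_(s, N) := \matrix_(i < s)
  (h *: (f (x0 + \sum_j mB M i j *: row j K)
       + g (x0 + \sum_j mC M i j *: row j K))).
pose U : set 'M[R]_(s, N) := [set K | `|K| <= rho'].
pose m := `|f x0| + `|g x0| + (L + L) * r.
have m0 : 0 <= m by rewrite /m !addr_ge0// mulr_ge0// ?addr_ge0// ltW.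
have Uball c K : (forall i, \sum_j `|c i j : R| <= T) -> U K ->
   forall i : 'I_s, `|\sum_j c i j *: row j K| <= r.
  move=> cT UK i; apply: le_trans Trho.
  apply: norm_weighted_sum => // [|j]; first exact: ltW.
  exact: le_trans (norm_row _ _) UK.
have lip0 F : (forall k k', `|k| <= r -> `|k'| <= r ->
    `|F (x0 + k) - F (x0 + k') : 'rV[R]_N| <= L * `|k - k'|) ->
    forall k, `|k| <= r -> `|F (x0 + k)| <= `|F x0| + L * r.
  move=> lipF k kr; rewrite -[F (x0 + k)](subrK (F x0)) addrC.
  rewrite (le_trans (ler_normD _ _))// lerD//.
  have := lipF k 0 kr; rewrite addr0 subr0 normr0 => /(_ (ltW r0)) /le_trans; apply.
  by rewrite ler_wpM2l.
have PhiU h : 0 <= h -> h * m <= rho' -> set_fun U U (Phi h).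
  move=> h0 hm K UK /=; apply: rowwise_norm => [|i]; first exact: ltW.
  rewrite rowK normrZ ger0_norm//; apply: le_trans hm; rewrite ler_wpM2l//.
  apply: le_trans (ler_normD _ _) _.
  have := lip0 f lipf _ (Uball _ K TB UK i).
  have := lip0 g lipg _ (Uball _ K TC UK i).
  rewrite /m; lra.
have PhiL h : 0 <= h -> forall K K', U K -> U K' ->
    `|Phi h K - Phi h K'| <= h * ((L + L) * T) * `|K - K'|.
  move=> h0 K K' UK UK'.
  apply: rowwise_norm => [|i].
    by rewrite !mulr_ge0// addr_ge0.
  rewrite linearB/= !rowK -scalerBr normrZ ger0_norm// -[leRHS]mulrA ler_wpM2l//.
  rewrite opprD addrACA (le_trans (ler_normD _ _))//.
  have sumK c : (forall i, \sum_j `|c i j : R| <= T) ->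
      `|\sum_j c i j *: row j K - \sum_j c i j *: row j K'| <= T * `|K - K'|.
    move=> cT; rewrite -sumrB; under eq_bigr do rewrite -scalerBr -linearB/=.
    by apply: norm_weighted_sum => // j; exact: norm_row.
  have := lipf _ _ (Uball _ K TB UK i) (Uball _ K' TB UK' i).
  have := lipg _ _ (Uball _ K TC UK i) (Uball _ K' TC UK' i).
  have := ler_wpM2l L0 (sumK _ TB); have := ler_wpM2l L0 (sumK _ TC).
  rewrite !mulrDl !mulrA; lra.
near=> h.
have h0 : 0 <= h by exact: ltW.
have hm : h * m <= rho'.
  by apply: ltW; near: h; exact: near0_mul_lt.
have hq : h * ((L + L) * T) < 1.
  by near: h; apply: near0_mul_lt; rewrite // mulr_ge0// addr_ge0.
pose q : {nonneg R} := NngNum (mulr_ge0 h0 (mulr_ge0 (addr_ge0 L0 L0) T0)).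
have [K UK KE] : exists2 K, U K & K = Phi h K.
  (* joins the norm and the completeness of the space of matrices *)
  pose X : completeNormedModType R := HB.pack 'M[R]_(s, N).
  apply: (@banach_fixed_point _ X U (mkfun_fun (PhiU h h0 hm))).
  - exists q; split=> //= -[K K'] [/= UK UK']; exact: PhiL.
  - have -> : U = closed_ball (0 : 'M[R]_(s, N)) rho'.
      rewrite closed_ballE//; apply/seteqP; split=> K.
        by rewrite /U/closed_ball_/= sub0r normrN.
      by rewrite /U/closed_ball_/= sub0r normrN.
    exact: closed_ball_closed.
  - by exists 0; rewrite /U/= normr0 ltW.
exists (fun i => row i K); split=> [|i].
  by apply/stagesE => i; rewrite [in LHS]KE rowK.
apply: le_trans (norm_row _ _) _; apply: le_trans UK _.
by rewrite ge_min lexx.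
Unshelve. all: by end_near. Qed.

(** * Second order *)

(** With F0 = f(x0) + g(x0), the bound K_i = O(h) improves first to
    K_i = h F0 + O(h^2) by the Lipschitz bounds, then to an expansion with
    remainder O(h^3) by the quadratic remainders. *)
Lemma stages_expansion (R : realType) (s N : nat) (M : asirk R s)
    (f g : 'rV[R]_N -> 'rV[R]_N) (A B : {linear 'rV[R]_N -> 'rV[R]_N})
    (x0 : 'rV[R]_N) (r L T P h : R) (K : 'I_s -> 'rV[R]_N) :
  quadratic_at f A x0 r L -> quadratic_at g B x0 r L ->
  (forall i, \sum_j `|mB M i j| <= T) -> (forall i, \sum_j `|mC M i j| <= T) ->
  0 <= r -> 0 <= L -> 0 <= T -> 0 <= P -> 0 <= h -> h * (T * P) <= r ->
  stages M f g h x0 K -> (forall i, `|K i| <= h * P) ->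
  forall i, `|K i - h *: (f x0 + g x0)
     - h ^+ 2 *: ((\sum_j mB M i j) *: A (f x0 + g x0)
                 + (\sum_j mC M i j) *: B (f x0 + g x0))|
    <= (L * (T * P) ^+ 2 + L * (T * (L * (T * P) *+ 2))) *+ 2 * h ^+ 3.
Proof.
move=> qf qg TB TC r0 L0 T0 P0 h0 hr /stagesE KE KP.
set F0 := f x0 + g x0.
have hP0 : 0 <= h * P by rewrite mulr_ge0.
have arg c : (forall i, \sum_j `|c i j : R| <= T) ->
    forall i : 'I_s, `|\sum_j c i j *: K j| <= h * (T * P).
  move=> cT i; apply: le_trans (norm_weighted_sum (cT i) hP0 KP) _.
  by rewrite mulrCA.
have lip0 F C : quadratic_at F C x0 r L -> forall k, `|k| <= h * (T * P) ->
    `|F (x0 + k) - F x0 : 'rV[R]_N| <= h * (L * (T * P)).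
  move=> [_ _ lip] k kh; have := lip k 0 (le_trans kh hr).
  rewrite addr0 subr0 normr0 => /(_ r0)/le_trans; apply.
  by rewrite mulrCA ler_wpM2l.
pose E := L * (T * P) *+ 2.
have K1 i : `|K i - h *: F0| <= h ^+ 2 * E.
  rewrite KE -scalerBr normrZ ger0_norm// expr2 -mulrA ler_wpM2l//.
  rewrite opprD addrACA (le_trans (ler_normD _ _))// mulrnAr mulr2n.
  by apply: lerD; [apply: (lip0 _ _ qf)|apply: (lip0 _ _ qg)]; exact: arg.
have rem (F : 'rV[R]_N -> 'rV[R]_N) C c : quadratic_at F C x0 r L ->
    (forall i, \sum_j `|c i j : R| <= T) -> forall i : 'I_s,
    `|F (x0 + \sum_j c i j *: K j) - F x0 - h *: ((\sum_j c i j) *: C F0)|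
      <= h ^+ 2 * (L * (T * P) ^+ 2 + L * (T * E)).
  move=> [remF linF _] cT i; set k := \sum_j c i j *: K j.
  have kh : `|k| <= h * (T * P) by exact: arg.
  have -> : F (x0 + k) - F x0 - h *: ((\sum_j c i j) *: C F0) =
     (F (x0 + k) - F x0 - C k) + C (\sum_j c i j *: (K j - h *: F0)).
    have -> : \sum_j c i j *: (K j - h *: F0) = k - h *: ((\sum_j c i j) *: F0).
      under eq_bigr do rewrite scalerBr; rewrite sumrB; congr (_ - _).
      rewrite scaler_suml scaler_sumr; apply: eq_bigr => j _.
      by rewrite scalerA mulrC -scalerA.
    rewrite [C (_ - _)]linearB [C (h *: _)]linearZ_LR [C (_ *: F0)]linearZ_LR.
    by rewrite addrA subrK.
  apply: le_trans (ler_normD _ _) _; rewrite mulrDr lerD//.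
    apply: le_trans (remF _ (le_trans kh hr)) _.
    rewrite [leRHS]mulrCA ler_wpM2l// -exprMn lerXn2r ?nnegrE//.
    by rewrite !mulr_ge0.
  apply: le_trans (linF _) _; rewrite [leRHS]mulrCA ler_wpM2l// [leRHS]mulrCA.
  by apply: norm_weighted_sum => //; rewrite !mulr_ge0// /E mulrn_wge0// !mulr_ge0.
move=> i; rewrite {1}KE.
set kB := \sum_j mB M i j *: K j; set kC := \sum_j mC M i j *: K j.
set beta := \sum_j mB M i j; set gamma := \sum_j mC M i j.
have -> : h *: (f (x0 + kB) + g (x0 + kC))
     - h *: F0 - h ^+ 2 *: (beta *: A F0 + gamma *: B F0)
   = h *: ((f (x0 + kB) - f x0 - h *: (beta *: A F0))
         + (g (x0 + kC) - g x0 - h *: (gamma *: B F0))).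
  rewrite expr2 -scalerA -!scalerBr; congr (h *: _).
  set u := f _; set v := g (_ + _).
  have -> : u + v - F0 = (u - f x0) + (v - g x0) by rewrite opprD addrACA.
  by rewrite scalerDr opprD addrACA.
rewrite normrZ ger0_norm// [leLHS]mulrC [h ^+ 3]exprSr [leRHS]mulrA ler_wpM2r//.
apply: le_trans (ler_normD _ _) _; rewrite -/E [leRHS]mulrC mulrnAr mulr2n.
by apply: lerD; [apply: (rem _ _ _ qf)|apply: (rem _ _ _ qg)].
Qed.

(** The three hypotheses are w^T e = 1, w^T B e = 1/2 and w^T C e = 1/2: they
    match the expansion of the update with
    y0 + h F0 + (h^2 / 2) (f' + g') F0, where F0 = f(y0) + g(y0). *)
Lemma second_order_of_conditions (R : realType) (s : nat) (M : asirk R s) :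
  \sum_i mw M i 0 = 1 ->
  \sum_i mw M i 0 * \sum_j mB M i j = 1 / 2 ->
  \sum_i mw M i 0 * \sum_j mC M i j = 1 / 2 ->
  second_order M.
Proof.
move=> w1 wB wC N f g fC gC y dy rho rho0.
have [rf [Lf [rf0 Lf0 qf]]] := classC2_quadratic (y 0) fC.
have [rg [Lg [rg0 Lg0 qg]]] := classC2_quadratic (y 0) gC.
pose r := Num.min rf rg; pose L := Num.max Lf Lg.
have r0 : 0 < r by rewrite lt_min rf0.
have L0 : 0 <= L by rewrite le_max Lf0.
have {}qf : quadratic_at f ('d f (y 0)) (y 0) r L.
  by apply: quadratic_atW qf; rewrite ?ge_min ?le_max lexx.
have {}qg : quadratic_at g ('d g (y 0)) (y 0) r L.
  by apply: quadratic_atW qg; rewrite ?ge_min ?le_max lexx orbT.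
have LL0 : 0 <= L + L by rewrite addr_ge0.
set x0 := y 0 in qf qg *.
set A := 'd f x0 in qf *; set B := 'd g x0 in qg *.
have [Q yQ] := solution_expansion r0 LL0 (quadratic_atD qf qg) dy.
have [T [T0 TB TC Tw]] := coefficients_bounded M.
have cf : continuous f by move=> x; apply: differentiable_continuous; apply: fC.1.
have cg : continuous g by move=> x; apply: differentiable_continuous; apply: gC.1.
have [Pf Pf0 fP] := continuous_bounded_ball x0 (T * rho) cf.
have [Pg Pg0 gP] := continuous_bounded_ball x0 (T * rho) cg.
pose P := Pf + Pg; have P0 : 0 <= P by rewrite addr_ge0.
pose E := (L * (T * P) ^+ 2 + L * (T * (L * (T * P) *+ 2))) *+ 2.
have E0 : 0 <= E.
  rewrite /E mulrn_wge0// addr_ge0// !mulr_ge0// ?sqr_ge0// mulrn_wge0//.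
  by rewrite !mulr_ge0.
exists (T * E + Q); near=> h; split.
  by near: h; exact: (stages_exist M r0 L0 rho0 qf qg).
move=> K Kst Krho.
have h0 : 0 <= h by apply: ltW.
have KP i : `|K i| <= h * P.
  have /stagesE KE := Kst; rewrite KE normrZ ger0_norm// ler_wpM2l//.
  apply: le_trans (ler_normD _ _) _; rewrite /P.
  by apply: lerD; [apply: fP|apply: gP]; apply: norm_weighted_sum => //; exact: ltW.
have hr : h * (T * P) <= r.
  by apply: ltW; near: h; apply: near0_mul_lt; rewrite // mulr_ge0.
have KE := stages_expansion qf qg TB TC (ltW r0) L0 T0 P0 h0 hr Kst KP.
rewrite -/E in KE; set F0 := f x0 + g x0 in KE.
pose D i := K i - h *: F0 - h ^+ 2 *: ((\sum_j mB M i j) *: A F0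
                 + (\sum_j mC M i j) *: B F0).
have -> : update M x0 K - y h =
   \sum_i mw M i 0 *: D i
   - (y h - (x0 + h *: (f \+ g) x0 + (h ^+ 2 / 2) *: (A \+ B) ((f \+ g) x0))).
  rewrite /update -[(f \+ g) x0]/F0 /=.
  have -> : \sum_i mw M i 0 *: K i = \sum_i mw M i 0 *: D i + h *: F0
     + (h ^+ 2 / 2) *: (A F0 + B F0).
    have KD i : K i = D i + h *: F0 + h ^+ 2 *: ((\sum_j mB M i j) *: A F0
                 + (\sum_j mC M i j) *: B F0) by rewrite [RHS]addrAC /D !subrK.
    clearbody D F0; under eq_bigr do rewrite KD !scalerDr.
    rewrite !big_split/= addrA -!addrA; congr (_ + _); congr (_ + _).
      by rewrite -scaler_suml w1 scale1r.
    have wX (c : 'I_s -> 'I_s -> R) (X : 'rV[R]_N) :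
        \sum_i mw M i 0 * (\sum_j c i j) = 1 / 2 ->
        \sum_i mw M i 0 *: (h ^+ 2 *: ((\sum_j c i j) *: X)) = (h ^+ 2 / 2) *: X.
      move=> wc.
      have -> : h ^+ 2 / 2 = h ^+ 2 * \sum_i mw M i 0 * (\sum_j c i j).
        by rewrite wc mul1r.
      rewrite [in RHS]mulr_sumr scaler_suml.
      by apply: eq_bigr => i _; rewrite !scalerA; congr (_ *: _); ring.
    by rewrite [RHS]scalerDr; congr (_ + _); exact: wX.
  by rewrite opprB [RHS]addrA; congr (_ - _); rewrite -!addrA [RHS]addrCA.
rewrite (le_trans (ler_normB _ _))// mulrDl lerD//.
  have hE : 0 <= h ^+ 3 * E by rewrite mulr_ge0// exprn_ge0.
  rewrite -mulrA [E * _]mulrC.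
  by apply: norm_weighted_sum => // i; rewrite mulrC; exact: KE.
by near: h.
Unshelve. all: by end_near. Qed.

(** * The family of methods *)
Lemma ord3P (P : 'I_3 -> Prop) : P 0 -> P 1 -> P 2%:R -> forall i, P i.
Proof.
move=> P0 P1 P2 [[|[|[|//]]] i3].
- by rewrite (_ : Ordinal i3 = 0)//; apply/val_inj.
- by rewrite (_ : Ordinal i3 = 1)//; apply/val_inj.
- by rewrite (_ : Ordinal i3 = 2%:R)//; apply/val_inj.
Qed.

Lemma sum3E (V : nmodType) (F : 'I_3 -> V) :
  \sum_j F j = F 0 + F 1 + F 2%:R.
Proof.
rewrite !big_ord_recl big_ord0 addr0 addrA.
by congr (F _ + F _ + F _); apply/val_inj.
Qed.

Lemma register_passP (R : realType) (V : lmodType R) (f g : V -> V) (h : R)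
    (om ga la : R) (r r' : registers V) :
  register_pass f g h om ga la r r' <->
  [/\ rY r' = rY r + om *: rK r, rL r' = h *: f (rY r' + ga *: rK r)
    & rK r' = rL r' + h *: g (rY r' + la *: rK r')].
Proof.
case: r r' => [Y L K] [Y' L' K']; split=> [[k [/= kE [-> -> ->]]]|/=[-> -> KE]].
  by [].
by exists K'.
Qed.

Section StifflyAccurate.
Context (R : realType) (b21 b32 w1 w2 w3 l2 : R).

Definition sa_method : asirk R 3 :=
  asirk3 b21 w1 b32 w1 w1 l2 w1 w2 w3 w1 w2 w3.

(** The fields [sa_wB], [sa_wC] and [sa_wBC] are w^T B e = 1/2,
    w^T C e = 1/2 (the last entry of C e is 1 by [sa_sum]) and
    w^T B C^-1 e = 1 multiplied by w1, with C^-1 e = (1 / w1, 0, 0). *)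
Record sa_conditions : Prop := {
  sa_w1 : 0 < w1; sa_l2 : 0 < l2; sa_w3 : 0 < w3;
  sa_sum : w1 + w2 + w3 = 1;
  sa_wB : w2 * b21 + w3 * (w1 + b32) = 1 / 2;
  sa_wC : w1 * w1 + w2 * (w1 + l2) + w3 = 1 / 2;
  sa_wBC : w2 * b21 + w3 * w1 = w1 }.

Lemma sa_second_order : sa_conditions -> second_order sa_method.
Proof.
move=> [_ _ _ ws wB wC _]; apply: second_order_of_conditions; rewrite !sum3E !mxE/=.
- exact: ws.
- by rewrite -wB; ring.
- by rewrite -wC ws; ring.
Qed.

Lemma sa_stagesP (V : lmodType R) (f g : V -> V) (h : R) (y : V)
    (K : 'I_3 -> V) :
  stages sa_method f g h y K <->
  [/\ K 0 = h *: (f y + g (y + w1 *: K 0)),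
      K 1 = h *: (f (y + b21 *: K 0) + g (y + (w1 *: K 0 + l2 *: K 1)))
    & K 2%:R = h *: (f (y + (w1 *: K 0 + b32 *: K 1))
                   + g (y + (w1 *: K 0 + w2 *: K 1 + w3 *: K 2%:R)))].
Proof.
have E (m : 'M[R]_3) i : \sum_j m i j *: K j =
    m i 0 *: K 0 + m i 1 *: K 1 + m i 2%:R *: K 2%:R by exact: sum3E.
split=> [/stagesE KE|[K0 K1 K2]].
  by split; rewrite [LHS]KE !E !mxE/= !scale0r ?add0r !addr0.
apply/stagesE; apply: ord3P; rewrite !E !mxE/= !scale0r ?add0r !addr0.
- exact: K0.
- exact: K1.
- exact: K2.
Qed.

Lemma sa_three_registers : three_registers sa_method.
Proof.
rewrite /three_registers !mxE/=.
exists (b21 - w1), (b32 - w2); split.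
- by apply/matrixP => i j; rewrite !mxE ![_ + (_ - _)]addrC !subrK.
- by [].
move=> N f g h y0 l0 K y1.
have upd : update sa_method y0 K = y0 + w1 *: K 0 + w2 *: K 1 + w3 *: K 2%:R.
  by rewrite /update sum3E !mxE/= !addrA.
have b21E : y0 + w1 *: K 0 + (b21 - w1) *: K 0 = y0 + b21 *: K 0.
  by rewrite -addrA -scalerDl [w1 + _]addrC subrK.
have b32E : y0 + w1 *: K 0 + w2 *: K 1 + (b32 - w2) *: K 1 =
    y0 + (w1 *: K 0 + b32 *: K 1).
  by rewrite -!addrA -scalerDl [w2 + _]addrC subrK.
split=> [[/sa_stagesP[K0 K1 K2] ->]|[r1 [r2 [r3 []]]]].
  exists (Registers y0 (h *: f y0) (K 0)).
  exists (Registers (y0 + w1 *: K 0) (h *: f (y0 + b21 *: K 0)) (K 1)).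
  exists (Registers (y0 + w1 *: K 0 + w2 *: K 1)
    (h *: f (y0 + (w1 *: K 0 + b32 *: K 1))) (K 2%:R)).
  split; [apply/register_passP..| |]; rewrite /= ?scaler0 ?addr0//.
  - by rewrite -scalerDr.
  - by rewrite b21E -scalerDr -addrA.
  - by rewrite b32E -scalerDr; split=> //; rewrite [LHS]K2 !addrA.
move=> /register_passP/= [Y1 L1 K1] /register_passP [Y2 L2 K2].
move=> /register_passP [Y3 L3 K3] [E0 E1 E2].
rewrite !scaler0 !addr0 in Y1 L1.
rewrite Y1 -E0 in Y2; rewrite Y2 -E1 in Y3.
rewrite L1 Y1 -E0 in K1; rewrite L2 Y2 -E1 -E0 b21E in K2.
rewrite L3 Y3 -E2 -E1 b32E in K3.
rewrite Y3 -E2 => ->; split=> //.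
apply/sa_stagesP; rewrite !scalerDr; split=> //; first by rewrite addrA.
by rewrite !addrA in K3 *.
Qed.

(** Since w^T is the last row of C, w^T C^-1 is the last basis row, and the
    second condition says that the last entry of C e is 1. *)
Lemma sa_additional_order_conditions :
  sa_conditions -> additional_order_conditions sa_method.
Proof.
move=> [w10 l20 w30 ws wB wC _].
have Cunit : mC sa_method \in unitmx.
  rewrite unitmxE det_trig; last first.
    by apply/is_trig_mxP => i j ij; rewrite mC_lower.
  rewrite unitfE; apply/prodf_neq0 => i _.
  by move: i; apply: ord3P; rewrite mxE/= gt_eqF.
split.
- by apply/matrixP => i j; rewrite !ord1 !mxE sum3E !mxE/= !mulr1.
- split=> //.
  have -> : (mw sa_method)^T = delta_mx 0 2%:R *m mC sa_method.
    apply/matrixP => i j; rewrite ord1 -rowE !mxE.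
    by move: j; apply: ord3P.
  rewrite mulmxK// -rowE; apply/matrixP => i j; rewrite !ord1 !mxE sum3E !mxE/=.
  by rewrite !mulr1 ws expr1n.
- apply/matrixP => i j; rewrite !ord1 -mulmxA !mxE sum3E !mxE !sum3E !mxE/=.
  by rewrite -wB; ring.
Qed.

End StifflyAccurate.

(** * Damping at infinity *)

(** Forward substitution solves (1 - x C) v = e.  For negative x all diagonal
    entries of 1 - x C are positive, and the numerators simplify because the
    first column of C is constant. *)
Lemma sa_stability_function (R : realType) (b21 b32 w1 w2 w3 l2 x : R) :
  sa_conditions b21 b32 w1 w2 w3 l2 -> x < 0 ->
  stability_function (sa_method b21 b32 w1 w2 w3 l2) 0 x%:C%C =
  ((1 + x * (w2 - l2)) / ((1 - x * w1) * (1 - x * l2) * (1 - x * w3)))%:C%C.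
Proof.
move=> [w10 l20 w30 _ _ _ _] x0.
have pos l : 0 < l -> 1 - x * l != 0.
  by move=> l0; rewrite gt_eqF// subr_gt0 (lt_trans _ ltr01)// nmulr_rlt0.
have [n1 n2 n3] := And3 (pos _ w10) (pos _ l20) (pos _ w30).
set M := sa_method _ _ _ _ _ _.
pose A : 'M[R]_3 := 1%:M - x *: mC M.
have Aunit : A \in unitmx.
  rewrite unitmxE det_trig; last first.
    apply/is_trig_mxP => i j ij; have := mC_lower M ij.
    rewrite !mxE => ->; rewrite -(inj_eq val_inj)/= ltn_eqF//.
    by rewrite mulr0 subr0.
  rewrite unitfE; apply/prodf_neq0 => i _.
  by move: i; apply: ord3P; rewrite !mxE/=.
pose v1 := (1 - x * w1)^-1.
pose v2 := v1 / (1 - x * l2).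
pose v3 := (1 + x * (w2 - l2)) / ((1 - x * w1) * (1 - x * l2) * (1 - x * w3)).
have vE : invmx A *m const_mx 1 = cv3 v1 v2 v3.
  have <- : A *m cv3 v1 v2 v3 = const_mx 1.
    apply/matrixP => i j; rewrite !mxE sum3E; move: i.
    by apply: ord3P; rewrite !mxE/= /v3 /v2 /v1; field; rewrite ?n1 ?n2 ?n3.
  by rewrite mulKmx.
rewrite /stability_function.
pose toC : {rmorphism R -> R[i]} := real_complex R.
rewrite -[fun x : R => _]/(toC : R -> R[i]) scale0r subr0 add0r.
have -> : 1%:M - x%:C%C *: map_mx toC (mC M) = map_mx toC A.
  by rewrite /A map_mxB map_mx1 map_mxZ.
have -> : (const_mx 1 : 'cV[R[i]]_3) = map_mx toC (const_mx 1).
  by rewrite map_const_mx rmorph1.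
rewrite map_trmx -map_invmx -!map_mxM/= mxE.
rewrite -mulmxA vE.
(* the last row of (1 - x C) v = e, which contains w *)
have -> : ((mw M)^T *m cv3 v1 v2 v3) 0 0 = (v3 - 1) / x.
  rewrite !mxE sum3E !mxE/= /v3 /v2 /v1; field.
  by rewrite n1 n2 n3 lt_eqF.
rewrite -[x%:C%C]/(toC x) -[((v3 - 1) / x)%:C%C]/(toC ((v3 - 1) / x)).
rewrite -(rmorph1 toC) -rmorphM -rmorphD.
by congr (toC _); rewrite mulrC divfK ?lt_eqF// addrC subrK.
Qed.

(** For x < -1 the numerator is O(|x|) while the denominator is at least
    x^2 w1 w3. *)
Lemma sa_damping (R : realType) (b21 b32 w1 w2 w3 l2 : R) :
  sa_conditions b21 b32 w1 w2 w3 l2 ->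
  implicit_damping (sa_method b21 b32 w1 w2 w3 l2).
Proof.
move=> sac; have [w10 l20 w30 _ _ _ _] := sac.
rewrite /implicit_damping.
apply/cvgrPdist_le => /= e e0.
have [er er0 eE] : exists2 er : R, 0 < er & e = er%:C%C.
  move: e0; rewrite ltcE/= => /andP[/eqP eI eR].
  by exists (complex.Re e) => //; apply/eqP; rewrite eq_complex/= eI !eqxx.
pose c := (1 + `|w2 - l2|) / (er * (w1 * w3)).
near=> x.
have x0 : x < 0 by near: x; exact: nbhs_ninfty_lt.
have x1 : x < -1 by near: x; apply: nbhs_ninfty_lt; exact: num_real.
have xc : x < - c by near: x; apply: nbhs_ninfty_lt; exact: num_real.
rewrite (sa_stability_function sac x0) sub0r normrN eE.
rewrite normc_def/= expr0n/= addr0 sqrtr_sqr lecE/= eqxx/=.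
have p2 : 1 <= 1 - x * l2 by rewrite lerDl oppr_ge0 nmulr_rle0// ltW.
have xN : 0 < - x by rewrite oppr_gt0.
have pos l : 0 < l -> - x * l <= 1 - x * l by move=> l0; rewrite mulNr lerDr.
rewrite normrM normfV ler_pdivrMr; last first.
  rewrite normr_gt0 !mulf_neq0// gt_eqF//.
  - by rewrite (lt_le_trans _ (pos _ w10))// mulr_gt0.
  - exact: lt_le_trans p2.
  - by rewrite (lt_le_trans _ (pos _ w30))// mulr_gt0.
have den : (- x) * (- x * (w1 * w3))
    <= `|(1 - x * w1) * (1 - x * l2) * (1 - x * w3)|.
  apply: le_trans (ler_norm _); have := pos _ w10; have := pos _ w30.
  have := mulr_gt0 xN w10; have := mulr_gt0 xN w30.
  set a := - x * w3; set b := - x * w1 => a0 b0 ha hb.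
  have -> : - x * (- x * (w1 * w3)) = b * 1 * a by rewrite /a /b; ring.
  by rewrite !ler_pM// ?mulr_ge0// ltW.
have num : `|1 + x * (w2 - l2)| <= - x * (1 + `|w2 - l2|).
  rewrite [leRHS]mulrDr mulr1 (le_trans (ler_normD _ _))// lerD//.
    by rewrite normr1 lerNr ltW.
  by rewrite normrM ltr0_norm.
apply: le_trans num _; apply: le_trans (ler_wpM2l (ltW er0) den).
rewrite mulrCA ler_wpM2l ?(ltW xN)// mulrCA -ler_pdivrMr ?mulr_gt0//.
by rewrite lerNr ltW.
Unshelve. all: by end_near. Qed.

(** * Bounds in the stiff range *)

(** A one-term version of the big O of the accuracy statement, on the fixed
    range h < 1: it is stable under sums and products, so remainders are
    estimated by following the shape of their formulas. *)
Definition stiff_bound (R : realType) (kappa : R) (F b : R -> R -> R) : Prop :=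
  exists2 A : R, 0 <= A & forall eps h : R,
    0 < h < 1 -> 0 < eps -> eps ^+ 2 <= kappa * h ^+ 3 ->
    `|F eps h| <= A * b eps h.

Section StiffBound.
Context (R : realType) (kappa : R).
Implicit Types F G b : R -> R -> R.

Lemma stiff_boundD F G b : stiff_bound kappa F b -> stiff_bound kappa G b ->
  stiff_bound kappa (fun eps h => F eps h + G eps h) b.
Proof.
move=> [A A0 FA] [B B0 GB]; exists (A + B) => [|eps h hh e0 eh].
  exact: addr_ge0.
rewrite mulrDl; apply: le_trans (ler_normD _ _) _.
by apply: lerD; [exact: FA|exact: GB].
Qed.

Lemma stiff_boundM F G b b' : stiff_bound kappa F b -> stiff_bound kappa G b' ->
  stiff_bound kappa (fun eps h => F eps h * G eps h)
    (fun eps h => b eps h * b' eps h).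
Proof.
move=> [A A0 FA] [B B0 GB]; exists (A * B) => [|eps h hh e0 eh].
  exact: mulr_ge0.
by rewrite normrM mulrACA ler_pM//; [exact: FA|exact: GB].
Qed.

Lemma stiff_boundZ (k : R) F b : stiff_bound kappa F b ->
  stiff_bound kappa (fun eps h => k * F eps h) b.
Proof.
move=> [A A0 FA]; exists (`|k| * A) => [|eps h hh e0 eh].
  exact: mulr_ge0.
by rewrite normrM -mulrA ler_wpM2l//; exact: FA.
Qed.

Lemma stiff_boundW (C : R) F b b' : 0 <= C ->
  (forall eps h, 0 < h < 1 -> 0 < eps -> eps ^+ 2 <= kappa * h ^+ 3 ->
    b eps h <= C * b' eps h) ->
  stiff_bound kappa F b -> stiff_bound kappa F b'.
Proof.
move=> C0 bb [A A0 FA]; exists (A * C) => [|eps h hh e0 eh].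
  exact: mulr_ge0.
apply: le_trans (FA _ _ hh e0 eh) _; rewrite -mulrA ler_wpM2l//.
exact: bb.
Qed.

(** The denominators eps + h l of the stages may be replaced by h l, which is
    smaller. *)
Lemma stiff_bound_div F b (l : R) : 0 < l ->
  stiff_bound kappa F (fun eps h => h * b eps h) ->
  stiff_bound kappa (fun eps h => F eps h / (eps + h * l)) b.
Proof.
move=> l0 [A A0 FA]; exists (A / l) => [|eps h /[dup] hh /andP[h0 h1] e0 eh].
  by rewrite divr_ge0// ltW.
have hl : 0 < h * l by rewrite mulr_gt0.
have el : 0 < eps + h * l by rewrite addr_gt0.
rewrite normrM normfV (gtr0_norm el) ler_pdivrMr//.
apply: le_trans (FA _ _ hh e0 eh) _.
have b0 : 0 <= A * b eps h.
  have := le_trans (normr_ge0 _) (FA _ _ hh e0 eh).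
  by rewrite mulrCA pmulr_rge0.
have -> : A * (h * b eps h) = (A * b eps h) / l * (h * l).
  by field; rewrite gt_eqF.
have -> : A / l * b eps h = A * b eps h / l by rewrite mulrAC.
by rewrite ler_wpM2l ?lerDr// ?divr_ge0// ltW.
Qed.

(** In the stiff range eps = O(h). *)
Lemma stiff_eps_le (eps h : R) : 0 < kappa -> 0 < h < 1 -> 0 < eps ->
  eps ^+ 2 <= kappa * h ^+ 3 -> eps <= (kappa + 1) * h.
Proof.
move=> kappa0 /andP[h0 h1] e0 eh; rewrite leNgt; apply/negP => lt.
have k1 : 0 < kappa + 1 by rewrite addr_gt0.
have : ((kappa + 1) * h) ^+ 2 < eps ^+ 2.
  by rewrite ltrXn2r// ?nnegrE ?mulr_ge0// ltW.
move=> /lt_le_trans/(_ eh); apply/negP; rewrite -leNgt exprMn exprS mulrA.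
rewrite ler_wpM2r ?sqr_ge0//.
have : kappa * h <= kappa by rewrite ler_piMr// ltW.
have := sqr_ge0 kappa; nra.
Qed.

Lemma stiff_bound_eq F G b : (forall eps h : R, 0 < h < 1 -> 0 < eps ->
    F eps h = G eps h) -> stiff_bound kappa F b -> stiff_bound kappa G b.
Proof.
move=> FG [A A0 FA]; exists A => // eps h hh e0 eh; rewrite -FG//; exact: FA.
Qed.

(** Passage from the truncated expansion m to the exact solution G: the error
    h eps^2 of the expansion is O(h^4) in the stiff range. *)
Lemma stiffO_sub F G (m g : R -> R -> R) : 0 < kappa ->
  (forall eps h : R, 0 < h -> 0 < eps -> 0 <= g eps h) ->
  stiff_bound kappa (fun eps h => F eps h - m eps h)
    (fun eps h => h ^+ 3 + g eps h) ->
  stiffO kappa (fun eps h => G eps h - m eps h)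
    (fun eps h => h ^+ 3) (fun eps h => h * eps ^+ 2) ->
  stiffO kappa (fun eps h => F eps h - G eps h) (fun eps h => h ^+ 3) g.
Proof.
move=> kappa0 g0 [A A0 FA] [B [h0 [h00 GB]]].
exists (A + `|B| * (1 + kappa)), (Num.min 1 h0).
split; first by rewrite lt_min ltr01.
move=> eps h /andP[hp]; rewrite lt_min => /andP[h1 hh0] e0 eh.
have Fh := FA eps h; rewrite hp h1 in Fh; have {}Fh := Fh isT e0 eh.
have Gh := GB eps h; rewrite hp hh0 in Gh; have {}Gh := Gh isT e0 eh.
have h3 : 0 <= h ^+ 3 by rewrite exprn_ge0// ltW.
have gh := g0 eps h hp e0.
rewrite (ger0_norm h3) (ger0_norm gh).
have he2 : 0 <= h * eps ^+ 2 by rewrite mulr_ge0 ?sqr_ge0// ltW.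
rewrite (ger0_norm h3) (ger0_norm he2) in Gh.
have he : h * eps ^+ 2 <= kappa * h ^+ 3.
  by apply: le_trans eh; rewrite ler_piMl ?sqr_ge0// ltW.
have -> : F eps h - G eps h = (F eps h - m eps h) - (G eps h - m eps h).
  by rewrite opprB addrA subrK.
apply: le_trans (ler_normB _ _) _; rewrite mulrDl; apply: lerD => //.
apply: le_trans Gh _; apply: le_trans (_ : `|B| * (h ^+ 3 + h * eps ^+ 2) <= _).
  by rewrite ler_wpM2r ?ler_norm// addr_ge0.
rewrite -mulrA ler_wpM2l// mulrDl mul1r lerD//; first by rewrite lerDl.
by apply: le_trans he _; rewrite ler_wpM2l ?lerDl// ltW.
Qed.

End StiffBound.

(** * The stages of the model problem *)
Lemma rv2P (R : realType) (x y : 'rV[R]_2) :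
  x = y <-> x 0 0 = y 0 0 /\ x 0 1 = y 0 1.
Proof.
split=> [->//|[x0 x1]]; apply/rowP => -[[|[|//]] i].
- by rewrite (_ : Ordinal i = 0)//; apply/val_inj.
- by rewrite (_ : Ordinal i = 1)//; apply/val_inj.
Qed.

Section ModelStages.
Context (R : realType) (d1 d2 s1 s2 c : R).
Local Notation ah := (ahat d1 s1 c).
Local Notation bh := (bhat d1 d2 s1 s2 c).
Local Notation ka := (s2 - c * s1).

(** One stage of the model problem in the variables (p, q - c p).  The argument
    of f is (Uf, c Uf + X); the argument of g is (Ug, c Ug + Y) without the
    implicit term and l is the diagonal entry of C.  The implicit equation
    is linear in q - c p with the nonzero coefficient eps + h l. *)
Lemma model_stage_solve (eps h l Uf X Ug Y p q : R) :
  0 < eps -> 0 < h -> 0 < l ->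
  (p = h * (d1 * Uf + s1 * (c * Uf + X)) /\
   q = h * (d2 * Uf + s2 * (c * Uf + X)
        + (c * (Ug + l * p) - (c * Ug + Y + l * q)) / eps)) <->
  (p = h * (ah * Uf + s1 * X) /\
   q = (eps * h * (bh * Uf + ka * X) - h * Y) / (eps + h * l) + c * p).
Proof.
move=> e0 h0 l0.
have ene : eps != 0 by rewrite gt_eqF.
have elne : eps + h * l != 0 by rewrite gt_eqF// addr_gt0// mulr_gt0.
have pE : h * (d1 * Uf + s1 * (c * Uf + X)) = h * (ah * Uf + s1 * X).
  by rewrite /ahat; ring.
split=> [[-> qE]|[-> qE]]; split=> //.
- rewrite pE in qE *; apply: (mulIf elne); rewrite [RHS]mulrDl divfK//.
  have qe : q * eps = h * (d2 * Uf + s2 * (c * Uf + X)) * eps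
     + h * (c * (Ug + l * (h * (ah * Uf + s1 * X))) - (c * Ug + Y + l * q)).
    by rewrite {1}qE; field.
  by rewrite mulrDr qe /ahat /bhat; ring.
- have qe : q * (eps + h * l) = (eps * h * (bh * Uf + ka * X) - h * Y) +
      c * (h * (ah * Uf + s1 * X)) * (eps + h * l).
    by rewrite qE mulrDl divfK.
  apply: (mulIf ene).
  have -> : q * eps = q * (eps + h * l) - q * (h * l) by ring.
  by rewrite qe /ahat /bhat; field.
Qed.

Context (b21 b32 w1 w2 w3 l2 u0 : R).

(** The u-component [stage_u1] of the first stage and its deviation
    [stage_dev1] are written as the solution provided by
    [model_stage_solve] with X = Y = 0; likewise for the next two stages. *)
Definition stage_u1 (eps h : R) := h * (ah * u0 + s1 * 0).
Definition stage_dev1 (eps h : R) :=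
  (eps * h * (bh * u0 + ka * 0) - h * 0) / (eps + h * w1).
Definition stage_u2 (eps h : R) :=
  h * (ah * (u0 + b21 * stage_u1 eps h) + s1 * (b21 * stage_dev1 eps h)).
Definition stage_dev2 (eps h : R) :=
  (eps * h * (bh * (u0 + b21 * stage_u1 eps h) + ka * (b21 * stage_dev1 eps h))
    - h * (w1 * stage_dev1 eps h)) / (eps + h * l2).
Definition stage_u3 (eps h : R) :=
  h * (ah * (u0 + (w1 * stage_u1 eps h + b32 * stage_u2 eps h))
     + s1 * (w1 * stage_dev1 eps h + b32 * stage_dev2 eps h)).
Definition stage_dev3 (eps h : R) :=
  (eps * h * (bh * (u0 + (w1 * stage_u1 eps h + b32 * stage_u2 eps h))
             + ka * (w1 * stage_dev1 eps h + b32 * stage_dev2 eps h))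
    - h * (w1 * stage_dev1 eps h + w2 * stage_dev2 eps h)) / (eps + h * w3).

Lemma model_stagesP (eps h : R) (K : 'I_3 -> 'rV[R]_2) :
  sa_conditions b21 b32 w1 w2 w3 l2 -> 0 < eps -> 0 < h ->
  stages (sa_method b21 b32 w1 w2 w3 l2)
    (model_f d1 d2 s1 s2) (model_g c eps) h (rv2 u0 (c * u0)) K <->
  [/\ K 0 = rv2 (stage_u1 eps h) (stage_dev1 eps h + c * stage_u1 eps h),
      K 1 = rv2 (stage_u2 eps h) (stage_dev2 eps h + c * stage_u2 eps h)
    & K 2%:R = rv2 (stage_u3 eps h) (stage_dev3 eps h + c * stage_u3 eps h)].
Proof.
move=> [w10 l20 w30 _ _ _ _] e0 h0.
have S1 := @model_stage_solve eps h w1 u0 0 u0 0 (K 0 0 0) (K 0 0 1) e0 h0 w10.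
have S2 := @model_stage_solve eps h l2
  (u0 + b21 * stage_u1 eps h) (b21 * stage_dev1 eps h)
  (u0 + w1 * stage_u1 eps h) (w1 * stage_dev1 eps h)
  (K 1 0 0) (K 1 0 1) e0 h0 l20.
have S3 := @model_stage_solve eps h w3
  (u0 + (w1 * stage_u1 eps h + b32 * stage_u2 eps h))
  (w1 * stage_dev1 eps h + b32 * stage_dev2 eps h)
  (u0 + (w1 * stage_u1 eps h + w2 * stage_u2 eps h))
  (w1 * stage_dev1 eps h + w2 * stage_dev2 eps h)
  (K 2%:R 0 0) (K 2%:R 0 1) e0 h0 w30.
rewrite sa_stagesP; split=> [[E0 E1 E2]|[k0 k1 k2]].
  have k0 : K 0 = rv2 (stage_u1 eps h) (stage_dev1 eps h + c * stage_u1 eps h).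
    apply/rv2P; rewrite ![rv2 _ _ _ _]mxE.
    move: E0 => /rv2P; rewrite !mxE/= => -[e1 e2].
    have [] := S1.1 _; last by move=> -> ->.
    by split; [rewrite [LHS]e1|rewrite [LHS]e2]; ring.
  have k1 : K 1 = rv2 (stage_u2 eps h) (stage_dev2 eps h + c * stage_u2 eps h).
    apply/rv2P; rewrite ![rv2 _ _ _ _]mxE.
    move: E1 => /rv2P; rewrite k0 !mxE/= => -[e1 e2].
    have [] := S2.1 _; last by move=> -> ->.
    by split; [rewrite [LHS]e1|rewrite [LHS]e2]; ring.
  have k2 : K 2%:R = rv2 (stage_u3 eps h) (stage_dev3 eps h + c * stage_u3 eps h).
    apply/rv2P; rewrite ![rv2 _ _ _ _]mxE.
    move: E2 => /rv2P; rewrite k0 k1 !mxE/= => -[e1 e2].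
    have [] := S3.1 _; last by move=> -> ->.
    by split; [rewrite [LHS]e1|rewrite [LHS]e2]; ring.
  by [].
split.
- have [|e1 e2] := S1.2 _; first by rewrite k0 !mxE.
  by apply/rv2P; split; [rewrite [LHS]e1|rewrite [LHS]e2]; rewrite !mxE/=; ring.
- have [|e1 e2] := S2.2 _; first by rewrite k1 !mxE.
  by apply/rv2P; split; [rewrite [LHS]e1|rewrite [LHS]e2]; rewrite k0 !mxE/=; ring.
- have [|e1 e2] := S3.2 _; first by rewrite k2 !mxE.
  apply/rv2P; split; [rewrite [LHS]e1|rewrite [LHS]e2];
    by rewrite k0 k1 !mxE/=; ring.
Qed.

Context (kappa : R) (kappa0 : 0 < kappa).
Context (sac : sa_conditions b21 b32 w1 w2 w3 l2).
Local Notation sb := (stiff_bound kappa).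

(* Bounds stated with Let stay in the context, where the closing // finds
   them. *)
Let sb_h : sb (fun eps h => h) (fun eps h => h).
Proof.
by exists 1 => // eps h /andP[h0 _] _ _; rewrite mul1r gtr0_norm.
Qed.

Let sb_eps : sb (fun eps h => eps) (fun eps h => eps).
Proof. by exists 1 => // eps h _ e0 _; rewrite mul1r gtr0_norm. Qed.

Let sb_epsW F : sb F (fun eps h => eps) -> sb F (fun eps h => h).
Proof.
apply: (@stiff_boundW _ _ (kappa + 1)) => [|eps h]; last exact: stiff_eps_le.
by rewrite addr_ge0// ltW.
Qed.

(** The size of the deviation of the second and third stages: eps h comes from
    the O(h) change of the argument of f, and eps^2 / h from the part eps dev_1
    of the first stage equation. *)
Definition layer (eps h : R) := eps * h + eps ^+ 2 / h.

Let h_layer (eps h : R) : 0 < h -> h * layer eps h = eps * h ^+ 2 + eps ^+ 2.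
Proof. by move=> h0; rewrite /layer; field; rewrite gt_eqF. Qed.

Let sb_layerW F : sb F layer -> sb F (fun eps h => h).
Proof.
move=> FL; apply: sb_epsW; move: FL.
apply: (@stiff_boundW _ _ (1 + (kappa + 1)))
  => [|eps h /[dup] hh /andP[h0 h1] e0 eh].
  by rewrite !addr_ge0// ltW.
rewrite /layer mulrDl; apply: lerD; first by rewrite mul1r ler_piMr// ltW.
rewrite ler_pdivrMr// expr2 [leRHS]mulrAC ler_wpM2r ?(ltW e0)//.
exact: (stiff_eps_le kappa0).
Qed.

Let stage_u1_bound : sb stage_u1 (fun eps h => h).
Proof.
apply: (@stiff_bound_eq _ _ (fun eps h => (ah * u0) * h)).
  by move=> eps h _ _; rewrite /stage_u1; ring.
exact: stiff_boundZ.
Qed.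

Let stage_dev1_bound : sb stage_dev1 (fun eps h => eps).
Proof.
apply: stiff_bound_div; first exact: sa_w1 sac.
apply: (@stiff_bound_eq _ _ (fun eps h => (bh * u0) * (h * eps))).
  by move=> eps h _ _; ring.
by apply: stiff_boundZ; apply: stiff_boundM.
Qed.

(** Replaces h w1 dev_1 by its leading term in the later stages, where that term
    cancels eps h bhat u0. *)
Let stage_dev1_eq (eps h : R) : 0 < h < 1 -> 0 < eps ->
  h * (w1 * stage_dev1 eps h) = eps * h * (bh * u0) - eps * stage_dev1 eps h.
Proof.
move=> /andP[h0 _] e0; have w10 := sa_w1 sac.
by rewrite /stage_dev1; field; rewrite gt_eqF// addr_gt0// mulr_gt0.
Qed.

Definition stage_u2_incr (eps h : R) :=
  h * (ah * b21 * stage_u1 eps h + s1 * b21 * stage_dev1 eps h).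

Let stage_u2_incr_bound : sb stage_u2_incr (fun eps h => h * h).
Proof.
apply: stiff_boundM => //; apply: stiff_boundD; apply: stiff_boundZ => //.
exact: sb_epsW.
Qed.

Let stage_u2_eq (eps h : R) : stage_u2 eps h = stage_u1 eps h + stage_u2_incr eps h.
Proof. by rewrite /stage_u2 /stage_u2_incr {2}/stage_u1; ring. Qed.

Let stage_u2_bound : sb stage_u2 (fun eps h => h).
Proof.
apply: (@stiff_bound_eq _ _ (fun eps h => stage_u1 eps h + stage_u2_incr eps h)).
  by move=> eps h _ _; rewrite stage_u2_eq.
apply: stiff_boundD => //.
apply: (@stiff_boundW _ _ 1 _ (fun eps h => h * h)) => //.
by move=> eps h /andP[h0 h1] _ _; rewrite mul1r ler_piMr// ltW.
Qed.

Let sb_drift F : sb F (fun eps h => h) ->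
  sb (fun eps h => eps * h * F eps h) (fun eps h => h * layer eps h).
Proof.
move=> Fh; apply: (@stiff_boundW _ _ 1 _ (fun eps h => eps * h * h)) => //.
  move=> eps h /andP[h0 _] e0 _; rewrite mul1r h_layer// -mulrA -expr2 lerDl.
  exact: sqr_ge0.
by apply: stiff_boundM => //; apply: stiff_boundM.
Qed.

Let sb_eps_dev1 :
  sb (fun eps h => eps * stage_dev1 eps h) (fun eps h => h * layer eps h).
Proof.
apply: (@stiff_boundW _ _ 1 _ (fun eps h => eps * eps)) => //.
  move=> eps h /andP[h0 _] e0 _; rewrite mul1r h_layer// -expr2 lerDr.
  by rewrite mulr_ge0 ?sqr_ge0 ?ltW.
exact: stiff_boundM.
Qed.

Let stage_dev2_bound : sb stage_dev2 layer.
Proof.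
apply: stiff_bound_div; first exact: sa_l2 sac.
apply: (@stiff_bound_eq _ _ (fun eps h =>
    eps * h * (bh * b21 * stage_u1 eps h + ka * b21 * stage_dev1 eps h)
    + eps * stage_dev1 eps h)).
  by move=> eps h hh e0; rewrite stage_dev1_eq//; ring.
apply: stiff_boundD => //; apply: sb_drift.
by apply: stiff_boundD; apply: stiff_boundZ => //; exact: sb_epsW.
Qed.

Definition drift3 (eps h : R) := bh * (w1 * stage_u1 eps h + b32 * stage_u2 eps h)
   + ka * (w1 * stage_dev1 eps h + b32 * stage_dev2 eps h).

Let drift3_bound : sb drift3 (fun eps h => h).
Proof.
apply: stiff_boundD; apply: stiff_boundZ; apply: stiff_boundD;
  apply: stiff_boundZ => //; [exact: sb_epsW|exact: sb_layerW].
Qed.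

Let stage_dev3_bound : sb stage_dev3 layer.
Proof.
apply: stiff_bound_div; first exact: sa_w3 sac.
apply: (@stiff_bound_eq _ _ (fun eps h =>
    eps * h * drift3 eps h + eps * stage_dev1 eps h
    + (- w2) * (h * stage_dev2 eps h))).
  move=> eps h hh e0; rewrite [h * (w1 * _ + _)]mulrDr stage_dev1_eq//.
  by rewrite /drift3; ring.
apply: stiff_boundD; first by apply: stiff_boundD => //; exact: sb_drift.
by apply: stiff_boundZ; exact: stiff_boundM.
Qed.

(** * Accuracy for the model problem *)
Definition error_u (eps h : R) :=
  u0 + (w1 * stage_u1 eps h + w2 * stage_u2 eps h + w3 * stage_u3 eps h)
  - model_u d1 d2 s1 s2 c u0 eps h.

(** The order conditions cancel the terms in h and h^2, and [sa_wBC] together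
    with [stage_dev1_eq] cancels the term in h eps. *)
Lemma error_u_eq (eps h : R) : 0 < h < 1 -> 0 < eps ->
  error_u eps h = ah * w3 * b32 * (h * stage_u2_incr eps h)
    + (- s1) * (eps * stage_dev1 eps h)
    + s1 * w3 * b32 * (h * stage_dev2 eps h).
Proof.
move=> hh e0; have [_ _ _ ws wB _ wBC] := sac.
have -> : error_u eps h =
   (w1 + w2 + w3) * stage_u1 eps h - h * ah * u0
   + h * ah * (w2 * b21 + w3 * (w1 + b32)) * stage_u1 eps h
   - 1 / 2 * ah ^+ 2 * h ^+ 2 * u0
   + h * ah * w3 * b32 * stage_u2_incr eps h
   + h * s1 * (w2 * b21 + w3 * w1) * stage_dev1 eps h
   + h * s1 * w3 * b32 * stage_dev2 eps h
   - s1 * bh * h * eps * u0.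
  have u3E : stage_u3 eps h = stage_u1 eps h + h *
      (ah * (w1 * stage_u1 eps h + b32 * (stage_u1 eps h + stage_u2_incr eps h))
        + s1 * (w1 * stage_dev1 eps h + b32 * stage_dev2 eps h)).
    by rewrite /stage_u3 stage_u2_eq [X in _ = X + _]/stage_u1; ring.
  rewrite /error_u u3E stage_u2_eq [X in w2 * (_ + X)]/stage_u2_incr /model_u.
  by ring.
rewrite ws wB wBC.
have -> : h * s1 * w1 * stage_dev1 eps h = s1 * (h * (w1 * stage_dev1 eps h)).
  by ring.
by rewrite stage_dev1_eq// /stage_u1; field.
Qed.

Lemma error_u_bound : sb error_u (fun eps h => h ^+ 3 + h ^+ 2 * eps).
Proof.
pose b (eps h : R) := h ^+ 3 + h ^+ 2 * eps.
have sb_h3 F : sb F (fun eps h => h ^+ 3) -> sb F b.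
  apply: (@stiff_boundW _ _ 1) => // eps h /andP[h0 _] e0 _.
  by rewrite mul1r lerDl mulr_ge0// ?exprn_ge0 ?ltW.
apply: (@stiff_bound_eq _ _ (fun eps h => ah * w3 * b32 * (h * stage_u2_incr eps h)
  + (- s1) * (eps * stage_dev1 eps h) + s1 * w3 * b32 * (h * stage_dev2 eps h))).
  by move=> eps h hh e0; rewrite error_u_eq.
apply: stiff_boundD; first (apply: stiff_boundD; apply: stiff_boundZ; apply: sb_h3).
- apply: (@stiff_boundW _ _ 1 _ (fun eps h => h * (h * h))) => //.
    by move=> eps h _ _ _; rewrite mul1r -expr2 -exprS.
  exact: stiff_boundM.
- apply: (@stiff_boundW _ _ kappa _ (fun eps h => eps * eps)) => //.
  + exact: ltW.
  + exact: stiff_boundM.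
- apply: stiff_boundZ.
  apply: (@stiff_boundW _ _ (1 + kappa) _ (fun eps h => h * layer eps h)).
  + by rewrite addr_ge0// ltW.
  + move=> eps h /andP[h0 h1] e0 eh; rewrite h_layer// /b.
    have e1 : 0 <= h ^+ 2 * eps by rewrite mulr_ge0 ?sqr_ge0 ?ltW.
    have e2 := mulr_ge0 (ltW kappa0) e1.
    have h3 : 0 <= h ^+ 3 by rewrite exprn_ge0// ltW.
    lra.
  + exact: stiff_boundM.
Qed.

Definition error_v (eps h : R) :=
  c * u0 + (w1 * (stage_dev1 eps h + c * stage_u1 eps h)
     + w2 * (stage_dev2 eps h + c * stage_u2 eps h)
     + w3 * (stage_dev3 eps h + c * stage_u3 eps h))
  - model_v d1 d2 s1 s2 c u0 eps h.

(** The third stage equation expresses w^T dev through dev_3, because the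
    weights are the last row of C. *)
Lemma error_v_eq (eps h : R) : 0 < h < 1 -> 0 < eps ->
  error_v eps h = c * error_u eps h + (- u0 * ah * bh) * (eps * h)
    + eps * drift3 eps h + (- 1) * (eps / h * stage_dev3 eps h).
Proof.
move=> /andP[h0 h1] e0; have w30 := sa_w3 sac.
have hne : h != 0 by rewrite gt_eqF.
pose wdev := w1 * stage_dev1 eps h + w2 * stage_dev2 eps h
  + w3 * stage_dev3 eps h.
have wdevE : wdev = eps * (bh * u0) + eps * drift3 eps h
    - eps / h * stage_dev3 eps h.
  have dev3E : h * w3 * stage_dev3 eps h = eps * h * (bh * u0 + drift3 eps h)
      - h * (w1 * stage_dev1 eps h + w2 * stage_dev2 eps h)
      - eps * stage_dev3 eps h.
    by rewrite /stage_dev3 /drift3; field; rewrite gt_eqF// addr_gt0// mulr_gt0.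
  apply: (mulIf hne).
  have -> : wdev * h = h * (w1 * stage_dev1 eps h + w2 * stage_dev2 eps h)
      + h * w3 * stage_dev3 eps h by rewrite /wdev; ring.
  by rewrite dev3E; field.
have -> : error_v eps h = c * error_u eps h + wdev
    + c * model_u d1 d2 s1 s2 c u0 eps h - model_v d1 d2 s1 s2 c u0 eps h.
  by rewrite /error_v /error_u /wdev; ring.
by rewrite wdevE /model_u /model_v; ring.
Qed.

Lemma error_v_bound : sb error_v (fun eps h => h ^+ 3 + h * eps).
Proof.
pose b (eps h : R) := h ^+ 3 + h * eps.
have h3 (h : R) : 0 < h -> 0 <= h ^+ 3 by move=> h0; rewrite exprn_ge0// ltW.
have sb_he F : sb F (fun eps h => eps * h) -> sb F b.
  apply: (@stiff_boundW _ _ 1) => // eps h /andP[h0 _] e0 _.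
  by rewrite mul1r mulrC lerDr h3.
apply: (@stiff_bound_eq _ _ (fun eps h =>
    c * error_u eps h + (- u0 * ah * bh) * (eps * h)
    + eps * drift3 eps h + (- 1) * (eps / h * stage_dev3 eps h))).
  by move=> eps h hh e0; rewrite error_v_eq.
apply: stiff_boundD; first (apply: stiff_boundD; first apply: stiff_boundD).
- apply: stiff_boundZ; apply: (@stiff_boundW _ _ 1 _ _ _ _ _ error_u_bound) => //.
  move=> eps h /andP[h0 h1] e0 _; rewrite mul1r lerD2l expr2 -mulrA ler_piMl//.
    by rewrite mulr_ge0// ltW.
  exact: ltW.
- by apply: sb_he; apply: stiff_boundZ; apply: stiff_boundM.
- by apply: sb_he; apply: stiff_boundM.
- apply: sb_he; apply: stiff_boundZ.
  have sb_mu : sb (fun eps h => eps / h) (fun eps h => eps / h).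
    exists 1 => // eps h /andP[h0 _] e0 _.
    by rewrite mul1r ger0_norm// divr_ge0// ltW.
  (* eps / h * layer = eps^2 + eps^3 / h^2, both O(eps h) *)
  apply: (@stiff_boundW _ _ (kappa + 1 + kappa) _
    (fun eps h => eps / h * layer eps h)).
  + by rewrite !addr_ge0// ltW.
  + move=> eps h /[dup] hh /andP[h0 h1] e0 eh.
    have -> : eps / h * layer eps h = eps * eps + eps * eps ^+ 2 / h ^+ 2.
      by rewrite /layer; field; rewrite gt_eqF.
    rewrite mulrDl; apply: lerD.
      rewrite mulrCA; apply: ler_wpM2l; first exact: ltW.
      exact: (stiff_eps_le kappa0).
    rewrite ler_pdivrMr ?exprn_gt0//.
    have -> : kappa * (eps * h) * h ^+ 2 = eps * (kappa * h ^+ 3) by ring.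
    by apply: ler_wpM2l => //; exact: ltW.
  + exact: stiff_boundM.
Qed.

Lemma model_stages_ex (eps h : R) : 0 < eps -> 0 < h ->
  exists K, stages (sa_method b21 b32 w1 w2 w3 l2)
    (model_f d1 d2 s1 s2) (model_g c eps) h (rv2 u0 (c * u0)) K.
Proof.
move=> e0 h0; exists (fun i => nth 0 [::
    rv2 (stage_u1 eps h) (stage_dev1 eps h + c * stage_u1 eps h);
    rv2 (stage_u2 eps h) (stage_dev2 eps h + c * stage_u2 eps h);
    rv2 (stage_u3 eps h) (stage_dev3 eps h + c * stage_u3 eps h)] i).
exact/model_stagesP.
Qed.

Lemma sa_model_accuracy_at (u v : R -> R -> R) :
  stiffO kappa (fun eps h => u eps h - model_u d1 d2 s1 s2 c u0 eps h)
    (fun eps h => h ^+ 3) (fun eps h => h * eps ^+ 2) ->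
  stiffO kappa (fun eps h => v eps h - model_v d1 d2 s1 s2 c u0 eps h)
    (fun eps h => h ^+ 3) (fun eps h => h * eps ^+ 2) ->
  forall u1 v1 : R -> R -> R,
  (forall eps h : R, 0 < eps -> 0 < h ->
     exists2 K, stages (sa_method b21 b32 w1 w2 w3 l2)
        (model_f d1 d2 s1 s2) (model_g c eps) h (rv2 u0 (c * u0)) K
       & rv2 (u1 eps h) (v1 eps h)
         = update (sa_method b21 b32 w1 w2 w3 l2) (rv2 u0 (c * u0)) K) ->
  stiffO kappa (fun eps h => u1 eps h - u eps h)
    (fun eps h => h ^+ 3) (fun eps h => h ^+ 2 * eps) /\
  stiffO kappa (fun eps h => v1 eps h - v eps h)
    (fun eps h => h ^+ 3) (fun eps h => h * eps).
Proof.
move=> uO vO u1 v1 num.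
have numE eps h : 0 < eps -> 0 < h ->
    u1 eps h - model_u d1 d2 s1 s2 c u0 eps h = error_u eps h /\
    v1 eps h - model_v d1 d2 s1 s2 c u0 eps h = error_v eps h.
  move=> e0 h0; have [K /(model_stagesP _ sac e0 h0)[K0 K1 K2]] := num eps h e0 h0.
  rewrite /update sum3E K0 K1 K2 => /rv2P; rewrite !mxE/= => -[-> ->].
  by rewrite /error_u /error_v.
split.
- apply: (stiffO_sub kappa0 _ _ uO) => [eps h h0 e0|].
    by rewrite mulr_ge0// ?sqr_ge0 ?ltW.
  apply: stiff_bound_eq error_u_bound => eps h /andP[h0 _] e0.
  by rewrite (numE eps h e0 h0).1.
- apply: (stiffO_sub kappa0 _ _ vO) => [eps h h0 e0|].
    by rewrite mulr_ge0// ltW.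
  apply: stiff_bound_eq error_v_bound => eps h /andP[h0 _] e0.
  by rewrite (numE eps h e0 h0).2.
Qed.

End ModelStages.

Lemma sa_model_accuracy (R : realType) (b21 b32 w1 w2 w3 l2 : R) :
  sa_conditions b21 b32 w1 w2 w3 l2 -> forall d1 d2 s1 s2 c : R,
  model_accuracy d1 d2 s1 s2 c (sa_method b21 b32 w1 w2 w3 l2).
Proof.
move=> sac d1 d2 s1 s2 c u0 kappa kappa0 u v _ uO vO.
split=> [eps h e0 h0|]; first exact: model_stages_ex.
exact: sa_model_accuracy_at.
Qed.

(** * The two methods *)
Lemma ASIRK_LSe_sa (R : realType) :
  exists b21 b32 w1 w2 w3 l2 : R, sa_conditions b21 b32 w1 w2 w3 l2 /\
    ASIRK_LSe R = sa_method b21 b32 w1 w2 w3 l2.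
Proof.
do 6!eexists; split; last by reflexivity.
split; lra.
Qed.

Lemma ASIRK_LSs_sa (R : realType) :
  exists b21 b32 w1 w2 w3 l2 : R, sa_conditions b21 b32 w1 w2 w3 l2 /\
    ASIRK_LSs R = sa_method b21 b32 w1 w2 w3 l2.
Proof.
do 6!eexists; split; last by reflexivity.
split; lra.
Qed.

Theorem mainTheorem2 (R : realType) (M : asirk R 3)
    (hM : M = ASIRK_LSe R \/ M = ASIRK_LSs R) :
  [/\ second_order M,
      three_registers M,
      additional_order_conditions M,
      implicit_damping M /\ (implicit_A_stable M -> implicit_L_stable M)
    & forall d1 d2 s1 s2 c : R, model_accuracy d1 d2 s1 s2 c M].
Proof.
have [b21 [b32 [w1 [w2 [w3 [l2 [sac ->]]]]]]] : exists b21 b32 w1 w2 w3 l2 : R,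
    sa_conditions b21 b32 w1 w2 w3 l2 /\ M = sa_method b21 b32 w1 w2 w3 l2.
  by case: hM => ->; [exact: ASIRK_LSe_sa|exact: ASIRK_LSs_sa].
have damp := sa_damping sac.
split.
- exact: sa_second_order.
- exact: sa_three_registers.
- exact: sa_additional_order_conditions.
- by split.
- exact: sa_model_accuracy.
Qed.
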